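(* Let $A$ be a finite set, let $G$ be an amenable discrete countable infinite group, let $(\mu_g)_{g\in G}$ be a family of probability measures on $A$, and let $X=A^G$, $\mu=\bigotimes_{g\in G}\mu_g$. Let $T=(T_g)_{g\in G}$ be the left shiftwise action of $G$ on $X$, $(T_gx)_h=x_{g^{-1}h}$ for $x=(x_h)_{h\in G}\in X$, $g,h\in G$, and assume that $T$ is nonsingular, i.e. $\mu\circ T_g\sim\mu$ for all $g\in G$. Suppose that $\inf_{g\in G}\min_{a\in A}\mu_g(a)>0$. Then: (i) If $T$ is conservative, then $T$ is weakly mixing. (ii) If for some integer $p>1$ the diagonal $G$-action $T\times\cdots\times T$ ($p$ times), i.e. $(T_g\times\cdots\times T_g)_{g\in G}$ on $(X^p,\mu^{\otimes p})$, is conservative, then this diagonal action is weakly mixing.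
   Context: A nonsingular action of a countable group $G$ on a $\sigma$-finite standard measure space $(Y,\nu)$ is a Borel action $Q=(Q_g)_{g\in G}$ with $\nu\circ Q_g\sim\nu$ (same null sets) for every $g$. For infinite $G$, $Q$ is conservative if for every measurable $B$ with $\nu(B)>0$ and for a.e. $y\in B$, the set $\{g\in G: Q_gy\in B\}$ is infinite. $Q$ is ergodic if every $Q$-invariant measurable set is null or conull. $Q$ is weakly mixing if for each ergodic measure preserving $G$-action $R=(R_g)_{g\in G}$ on a standard probability space, the product $G$-action $(Q_g\times R_g)_{g\in G}$ is ergodic (with respect to the product measure). *)

(* Defs.v *)
From HB Require Import structures.
From mathcomp Require Import all_boot all_order all_algebra finmap.
From mathcomp Require Import all_classical all_reals all_analysis.

Set Implicit Arguments.
Unset Strict Implicit.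
Unset Printing Implicit Defensive.

Import Order.TTheory GRing.Theory Num.Theory.
Import numFieldNormedType.Exports.

Local Open Scope classical_set_scope.
Local Open Scope ring_scope.

(* Amenability of a countable discrete group: existence of a (left) Følner
   sequence [F n] of nonempty finite sets,
   #|g F_n \triangle F_n| / #|F_n| --> 0 for every [g].  *)
Definition translate (G : groupType) (g : G) (F : {fset G}) : {fset G} :=
  [fset (g * h)%g | h in F]%fset.

Definition fsymdiff (K : choiceType) (E F : {fset K}) : {fset K} :=
  ((E `\` F) `|` (F `\` E))%fset.

Definition amenable (R : realType) (G : groupType) : Prop :=
  exists F : nat -> {fset G},
    (forall n, F n != fset0) /\
    (forall g : G,
      (#|` fsymdiff (translate g (F n)) (F n)|%:R / #|` F n|%:R : R)
        @[n --> \oo] --> (0 : R)).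

(* [funspace I T] is the set of all maps I -> T with the product
   sigma-algebra, i.e. the one generated by the coordinate projections. *)
Definition coord_preimages (I : Type) d (T : measurableType d) :
    set (set (I -> T)) :=
  [set (fun x : I -> T => x i) @^-1` B | i in [set: I] & B in measurable].

Definition funspace (I : Type) d (T : measurableType d) :=
  g_sigma_algebraType (@coord_preimages I d T).

(* [m] is the product of the probability measures [nu i], i \in I: the measure
   of every measurable box depending on finitely many coordinates is the product
   of the measures of its sides (this determines [m]). *)
Definition is_product_measure (R : realType) (I : choiceType) d
    (T : measurableType d) (nu : I -> probability T R)
    (m : probability (funspace I T) R) : Prop :=
  forall (F : {fset I}) (B : I -> set T),
    (forall i, i \in F -> measurable (B i)) ->
    m [set x : funspace I T | forall i, i \in F -> B i (x i)] =
      (\prod_(i <- F) nu i (B i))%E.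

(* The sigma-algebra of [Z] is the Borel sigma-algebra of a Polish topology on
   [Z]; the topology is transported from a separable complete metric space [M]
   along a bijection [f]. *)
Definition standard_borel (R : realType) d (Z : measurableType d) : Prop :=
  exists (M : metricType R) (f : Z -> M),
    [/\ (forall u : nat -> M, cauchy (u @ \oo) -> exists l : M, u @ \oo --> l),
        (exists2 D : set M, countable D & dense D),
        bijective f &
        (measurable : set (set Z)) = [set f @^-1` C | C in <<s @open M >>]].

Section Actions.
Context (G : groupType).

(* [G] is discrete and countable, so that an action is Borel as soon as each
   [Q g] is. *)
Definition borel_action d (Y : measurableType d) (Q : G -> Y -> Y) : Prop :=
  [/\ (forall y, Q 1%g y = y),
      (forall g h y, Q (g * h)%g y = Q g (Q h y)) &
      (forall g, measurable_fun [set: Y] (Q g))].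

Definition nonsingular (R : realType) d (Y : measurableType d)
    (nu : set Y -> \bar R) (Q : G -> Y -> Y) : Prop :=
  forall g (B : set Y), measurable B ->
    nu (Q g @` B) = 0%E <-> nu B = 0%E.

Definition measure_preserving (R : realType) d (Y : measurableType d)
    (nu : set Y -> \bar R) (Q : G -> Y -> Y) : Prop :=
  forall g (B : set Y), measurable B -> nu (Q g @^-1` B) = nu B.

Definition conservative (R : realType) d (Y : measurableType d)
    (nu : {measure set Y -> \bar R}) (Q : G -> Y -> Y) : Prop :=
  forall B : set Y, measurable B -> (0 < nu B)%E ->
    {ae nu, forall y, B y -> infinite_set [set g | B (Q g y)]}.

Definition ergodic (R : realType) d (Y : measurableType d)
    (nu : set Y -> \bar R) (Q : G -> Y -> Y) : Prop :=
  forall B : set Y, measurable B -> (forall g, Q g @^-1` B = B) ->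
    nu B = 0%E \/ nu (~` B) = 0%E.

Definition weakly_mixing (R : realType) d (Y : measurableType d)
    (nu : {sigma_finite_measure set Y -> \bar R}) (Q : G -> Y -> Y) : Prop :=
  forall (d' : measure_display) (Z : measurableType d')
      (lambda : probability Z R) (S : G -> Z -> Z),
    standard_borel R Z -> borel_action S ->
    measure_preserving lambda S -> ergodic lambda S ->
    ergodic (nu \x lambda)%E (fun g (yz : Y * Z) => (Q g yz.1, S g yz.2)).

End Actions.

Definition shift_action (G : groupType) d (A : measurableType d) (g : G)
    (x : funspace G A) : funspace G A :=
  fun h => x (g^-1 * h)%g.
Arguments shift_action G {d} A g x.

Definition diag_action (G : Type) (p : nat) d (Y : measurableType d)
    (Q : G -> Y -> Y) (g : G) (x : funspace 'I_p Y) : funspace 'I_p Y :=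
  fun i => Q g (x i).
Arguments diag_action {G} p {d Y} Q g x.

(* Main.v *)
Require Import Defs.
From HB Require Import structures.
From mathcomp Require Import all_boot all_order all_algebra finmap.
From mathcomp Require Import all_classical all_reals all_analysis.
From mathcomp Require Import measurable_realfun.
From mathcomp Require Import ring lra.

Set Implicit Arguments.
Unset Strict Implicit.
Unset Printing Implicit Defensive.

Import Order.TTheory GRing.Theory Num.Theory.
Import numFieldNormedType.Exports.

Local Open Scope classical_set_scope.
Local Open Scope ring_scope.

(** The idea is to show that a set [B] invariant under [Q x S], with [Q] the
shift and [S] an ergodic measure preserving action on [Z], is insensitive, up
to a null set, to swapping two letters at a single coordinate of the first
factor. A zero-one law for product measures then makes almost every slice of
[B] null or conull, the set of [z] with non-null slice is invariant under [S],
and the ergodicity of [S] concludes ([coordinate_action_weakly_mixing]).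

Insensitivity to a swap [t] comes from a coupling argument. Let [P] be the
product measure, [U = Q x S], and [w g] the density of [E |-> P (U g E)]. For a
finite set [F] of group elements, the functions [w u * w v / \sum_(g in F) w g]
are the densities of measures [m_uv], symmetric in [u] and [v], with [\sum_v
m_uv E = P (U u E)]. Since the marginals are bounded below, every conjugate of
[t] by the action multiplies [P] by at most a constant [C]; hence it changes
each [w g] by a factor at most [C ^ 2] and [m_uv] by at most [C ^ 7]. Now let
[L] be an approximation of [B] depending on finitely many coordinates of the
first factor. For [g] outside a finite set [K], the points [U g (t x)] and [U g
x] are on the same side of [L], whereas [B] separates them as soon as it
separates [t x] and [x]: one of them lies in the symmetric difference of [L]
and [B]. Writing this for [x = U u y] and [g = v u^-1], integrating against
[m_uv] and summing over [u] and [v] in [F] gives ([displacement_le])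

[|F| P (t^-1 B \ B) <= (1 + C ^ 7) |F| P (L symdiff B) + 2 |K| \sum_u m_uu(W)].

The diagonal masses [m_uu(W)], that is, the integrals of [w u ^ 2 / \sum_(g in
F) w g], are where conservativity and amenability enter. By Borel-Cantelli,
conservativity forces [\sum_g w g] to diverge almost everywhere
([conservative_sweeping]), so that a finite sum over some [K0] is already large
on most of the space; and if [F] is a Folner set, then [K0 u] is contained in
[F] for most [u] in [F], for which [m_uu(W)] is small
([coupling_mass_diag_small]). Letting [F] grow, and then [L] approach [B],
gives [P (t^-1 B \ B) = 0] ([displacement_null]).

The diagonal action on the power of the shift space is treated by the same
theorem: its coordinates are indexed by ['I_p * G] ([power_coordinates]), and
it is nonsingular because it can be performed one factor at a time
([map_coordinates_null]). *)

(** * Densities of images of a probability measure *)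

Lemma measurable_preimage d d' (X : measurableType d) (X' : measurableType d')
    (f : X -> X') (E : set X') :
  measurable_fun [set: X] f -> measurable E -> measurable (f @^-1` E).
Proof. by move=> mf mE; rewrite -[X in measurable X]setTI; exact: mf. Qed.

Section ImageProbability.
Context (R : realType) d d' (X : measurableType d) (X' : measurableType d').
Variables (P : probability X R) (f : X -> X').
Hypothesis mf : measurable_fun [set: X] f.

Definition image_probability : probability X' R :=
  let fP : {mfun X >-> X'} := HB.pack f (isMeasurableFun.Build _ _ _ _ f mf) in
  distribution P fP.

Lemma image_probabilityE E : image_probability E = P (f @^-1` E).
Proof. by []. Qed.

Lemma integral_image_probability (E : set X') (h : X' -> \bar R) :
  measurable E -> measurable_fun [set: X'] h -> (forall x, 0 <= h x)%E ->
  (\int[image_probability]_(y in E) h y = \int[P]_(x in f @^-1` E) h (f x))%E.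
Proof.
by move=> mE mh h0; rewrite ge0_integral_pushforward//; exact: measurable_funTS.
Qed.

End ImageProbability.

Section Densities.
Context (R : realType) d (W : measurableType d).
Implicit Types P : probability W R.

(** The density of an image measure is used through the change of variables
formula rather than through the measures of sets, since it is integrals of
nonnegative functions that get transported below; a real valued density makes
quotients available. *)
Definition image_density P (f : W -> W) (w : W -> R) : Prop :=
  [/\ measurable_fun [set: W] f, measurable_fun [set: W] w,
      (forall x, 0 <= w x) &
      forall E (h : W -> R), measurable E -> measurable_fun [set: W] h ->
        (forall x, 0 <= h x) ->
        (\int[P]_(x in f @^-1` E) (h (f x))%:E =
         \int[P]_(x in E) (h x * w x)%:E)%E].

Lemma exists_image_density P (f : W -> W) :
  measurable_fun [set: W] f ->
  (forall E, measurable E -> P E = 0%E -> P (f @^-1` E) = 0%E) ->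
  exists w, image_density P f w.
Proof.
move=> mf ns.
have dom : image_probability P mf `<< P by apply/null_content_dominatesP.
pose r := Radon_Nikodym_SigmaFinite.f (image_probability P mf) P.
have r0 := Radon_Nikodym_SigmaFinite.f_ge0 dom.
exists (fine \o r); split => //.
- apply: measurableT_comp => //.
  exact: measurable_int (Radon_Nikodym_SigmaFinite.f_integrable dom).
- by move=> x; rewrite fine_ge0.
- move=> E h mE mh h0.
  rewrite -(@integral_image_probability _ _ _ _ _ P f mf E (EFin \o h))//;
    last exact/measurable_EFinP.
  rewrite -(Radon_Nikodym_SigmaFinite.change_of_variables dom)//.
  + apply: eq_integral => x _ /=.
    by rewrite EFinM fineK// Radon_Nikodym_SigmaFinite.f_fin_num.
  + exact/measurable_EFinP/measurable_funTS.
Qed.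

Lemma image_densityE P f w E : image_density P f w -> measurable E ->
  P (f @^-1` E) = (\int[P]_(x in E) (w x)%:E)%E.
Proof.
move=> [mf mw w0 wE] mE.
have /= := wE E (cst 1) mE (measurable_cst _) (fun=> ler01).
under [in RHS]eq_integral do rewrite mul1r.
by move=> <-; rewrite integral_cst ?mul1e//; exact: measurable_preimage.
Qed.

Lemma image_density_lty P f w E : image_density P f w -> measurable E ->
  (\int[P]_(x in E) (w x)%:E < +oo)%E.
Proof.
move=> dw mE; have [mf _ _ _] := dw; rewrite -(image_densityE dw)//.
by apply: le_lt_trans (ltry 1); apply: probability_le1; exact: measurable_preimage.
Qed.

Lemma ge0_le_integralEFin P (f g : W -> R) E : measurable E ->
  measurable_fun [set: W] f -> measurable_fun [set: W] g ->
  (forall x, 0 <= f x) -> (forall x, 0 <= g x) ->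
  {ae P, forall x, E x -> f x <= g x} ->
  (\int[P]_(x in E) (f x)%:E <= \int[P]_(x in E) (g x)%:E)%E.
Proof.
move=> mE mf mg f0 g0 fg; apply: ae_ge0_le_integral => //.
- by move=> x _; rewrite lee_fin.
- exact/measurable_EFinP/measurable_funTS.
- by move=> x _; rewrite lee_fin.
- exact/measurable_EFinP/measurable_funTS.
Qed.

(** On the part of [D] where [g < f], the hypothesis forces the integrals of
[f] and [g] over every subset to agree, so that [f = g] almost everywhere
there. *)
Lemma ae_le_of_integral_le P (f g : W -> R) (D : set W) :
  measurable D -> measurable_fun [set: W] f -> measurable_fun [set: W] g ->
  (forall x, 0 <= f x) -> (forall x, 0 <= g x) ->
  (\int[P]_(x in D) (f x)%:E < +oo)%E ->
  (forall E, measurable E -> E `<=` D ->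
    (\int[P]_(x in E) (f x)%:E <= \int[P]_(x in E) (g x)%:E)%E) ->
  {ae P, forall x, D x -> f x <= g x}.
Proof.
move=> mD mf mg f0 g0 fint fg.
pose E := D `&` [set x | g x < f x].
have mltgf : measurable [set x | g x < f x].
  have -> : [set x | g x < f x] = (fun x => g x < f x) @^-1` [set true].
    by apply/seteqP; split=> x /=.
  by apply: measurable_preimage => //; exact: measurable_fun_ltr.
have mE : measurable E by exact: measurableI.
have fE : P.-integrable E (EFin \o f).
  apply/integrableP; split; first exact/measurable_EFinP/measurable_funTS.
  under eq_integral do rewrite /= ger0_norm//.
  apply: le_lt_trans fint; apply: ge0_subset_integral => //.
  - exact/measurable_EFinP/measurable_funTS.
  - by move=> x _; rewrite lee_fin.
  - by move=> x [].
have EE := @integral_ae_eq _ _ _ P E mE (EFin \o g) _ fE.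
have {}EE : ae_eq P E (EFin \o f) (EFin \o g).
  apply: EE; first exact/measurable_EFinP/measurable_funTS.
  move=> F FE mF; apply/eqP; rewrite eq_le; apply/andP; split.
    by apply: fg => // x /FE[].
  apply: ge0_le_integral => //=.
  - by move=> x _; rewrite lee_fin.
  - exact/measurable_EFinP/measurable_funTS.
  - exact/measurable_EFinP/measurable_funTS.
  - by move=> x /FE[_ /= /ltW]; rewrite lee_fin.
apply: filterS EE => x /= H Dx; rewrite leNgt; apply/negP => lt.
by have := H (conj Dx lt); case=> /eqP; rewrite gt_eqF.
Qed.

End Densities.

(** * Maps multiplying a measure by at most a constant *)

Section QuasiInvariance.
Context (R : realType) d (W : measurableType d).
Variable P : probability W R.

Lemma ae_comp (s : W -> W) (Q : W -> Prop) :
  measurable_fun [set: W] s ->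
  (forall E, measurable E -> P E = 0%E -> P (s @^-1` E) = 0%E) ->
  {ae P, forall x, Q x} -> {ae P, forall x, Q (s x)}.
Proof.
move=> ms ns [N [mN N0 QN]]; exists (s @^-1` N); split.
- exact: measurable_preimage.
- exact: ns.
- by move=> x /= nQ; apply: QN.
Qed.

Lemma involutive_preimageK (T : Type) (s : T -> T) (E : set T) :
  involutive s -> s @^-1` (s @^-1` E) = E.
Proof. by move=> ss; rewrite -comp_preimage (_ : s \o s = id) //; apply/funext. Qed.

Definition quasi_invariant (C : R) (s : W -> W) : Prop :=
  measurable_fun [set: W] s /\
  forall E, measurable E -> (P (s @^-1` E) <= C%:E * P E)%E.

Lemma quasi_invariant_null C s E : quasi_invariant C s ->
  measurable E -> P E = 0%E -> P (s @^-1` E) = 0%E.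
Proof.
move=> [ms sC] mE E0; apply/eqP; rewrite eq_le measure_ge0 andbT.
by rewrite (le_trans (sC _ mE))// E0 mule0.
Qed.

(** The density of the image of [P] under [s] is almost everywhere at most [C].
*)
Lemma quasi_invariant_integral C s (h : W -> R) E : quasi_invariant C s ->
  measurable E -> measurable_fun [set: W] h -> (forall x, 0 <= h x) -> 0 <= C ->
  (\int[P]_(x in s @^-1` E) (h (s x))%:E <= C%:E * \int[P]_(x in E) (h x)%:E)%E.
Proof.
move=> qs mE mh h0 C0.
have [ms sC] := qs.
have [w dw] := exists_image_density ms (fun E => @quasi_invariant_null C s E qs).
have [_ mw w0 wE] := dw.
rewrite wE// -ge0_integralZl_EFin//; last 2 first.
- by move=> x _; rewrite lee_fin.
- exact/measurable_EFinP/measurable_funTS.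
apply: ge0_le_integralEFin => //.
- exact: measurable_funM.
- exact: measurable_funM.
- by move=> x; rewrite mulr_ge0.
- by move=> x; rewrite mulr_ge0.
have : {ae P, forall x, setT x -> w x <= C}.
  apply: ae_le_of_integral_le => //.
    exact: image_density_lty dw _.
  move=> F mF _; rewrite -(image_densityE dw)// integral_cst//; exact: sC.
by apply: filterS => x H _; rewrite mulrC ler_wpM2r// H.
Qed.

(** Pushing the density [w] of the image of [P] by [f] along [s] costs one
factor [C] for that image and another one for [P] itself; as [s] is an
involution, the estimate can be reversed. *)
Lemma image_density_quasi_invariant C s f w :
  image_density P f w -> involutive s -> quasi_invariant C s -> 0 <= C ->
  (forall E, measurable E -> (P (f @^-1` (s @^-1` E)) <= C%:E * P (f @^-1` E))%E) ->
  {ae P, forall x, w x <= C ^+ 2 * w (s x) /\ w (s x) <= C ^+ 2 * w x}.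
Proof.
move=> dw ss qs C0 sC; have [mf mw w0 _] := dw; have [ms _] := qs.
have H : {ae P, forall x, w x <= C ^+ 2 * w (s x)}.
  have mws : measurable_fun [set: W] (w \o s) by exact: measurableT_comp.
  suff : {ae P, forall x, setT x -> w x <= C ^+ 2 * (w \o s) x}.
    by apply: filterS => x; apply.
  apply: ae_le_of_integral_le => //=.
  - exact: measurable_funM.
  - by move=> x; rewrite mulr_ge0// exprn_ge0.
  - exact: image_density_lty dw _.
  move=> E mE _; rewrite -(image_densityE dw)//.
  have msE : measurable (s @^-1` E) by exact: measurable_preimage.
  rewrite -[in leLHS](involutive_preimageK E ss).
  apply: le_trans (sC _ msE) _; rewrite (image_densityE dw)//.
  under [leRHS]eq_integral do rewrite EFinM.
  rewrite ge0_integralZl_EFin//; last 3 first.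
  - by move=> x _; rewrite lee_fin.
  - exact/measurable_EFinP/measurable_funTS.
  - exact: exprn_ge0.
  rewrite expr2 EFinM -muleA; apply: lee_wpmul2l; rewrite ?lee_fin//.
  have := quasi_invariant_integral qs mE mws (fun=> w0 _) C0.
  by apply: le_trans; rewrite le_eqVlt; apply/orP; left; apply/eqP;
    apply: eq_integral => x _ /=; rewrite ss.
have H' := ae_comp ms (fun E => @quasi_invariant_null C s E qs) H.
by apply: filterS2 H H' => x /= ?; rewrite ss.
Qed.

(** A measure whose density changes by at most [c] along [s] is itself
multiplied by at most [c * C]. *)
Lemma transport_bound C c s (h : W -> R) E :
  quasi_invariant C s -> 0 <= C -> 0 <= c -> measurable E ->
  measurable_fun [set: W] h -> (forall x, 0 <= h x) ->
  {ae P, forall x, h x <= c * h (s x)} ->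
  (\int[P]_(x in s @^-1` E) (h x)%:E <= (c * C)%:E * \int[P]_(x in E) (h x)%:E)%E.
Proof.
move=> qs C0 c0 mE mh h0 hs; have [ms _] := qs.
have msE : measurable (s @^-1` E) by exact: measurable_preimage.
have mhs : measurable_fun [set: W] (h \o s) by exact: measurableT_comp.
apply: (@le_trans _ _ (\int[P]_(x in s @^-1` E) (c * h (s x))%:E)%E).
  apply: ge0_le_integralEFin => //.
  - exact: measurable_funM.
  - by move=> x; rewrite mulr_ge0.
  - by apply: filterS hs.
under eq_integral do rewrite EFinM.
rewrite ge0_integralZl_EFin//; last 2 first.
- by move=> x _; rewrite lee_fin.
- exact/measurable_EFinP/measurable_funTS.
rewrite EFinM -muleA; apply: lee_wpmul2l; rewrite ?lee_fin//.
exact: quasi_invariant_integral.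
Qed.

End QuasiInvariance.

(** * Couplings of the translates of a measure *)

Section Coupling.
Context (R : realType) (G : groupType) d (W : measurableType d).
Variables (P : probability W R) (U : G -> W -> W) (w : G -> W -> R).
Hypothesis U_action : borel_action U.
Hypothesis w_density : forall g, image_density P (U g^-1%g) (w g).

Let mU g : measurable_fun [set: W] (U g). Proof. by case: U_action. Qed.
Let mw g : measurable_fun [set: W] (w g). Proof. by case: (w_density g). Qed.
Let w0 g x : 0 <= w g x. Proof. by case: (w_density g). Qed.

Definition window_sum (F : seq G) (x : W) : R := \sum_(g <- F) w g x.

Lemma window_sum_ge0 F x : 0 <= window_sum F x.
Proof. by apply: sumr_ge0 => g _. Qed.

Lemma measurable_window_sum F : measurable_fun [set: W] (window_sum F).
Proof.
elim: F => [|g F IH].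
  rewrite (_ : window_sum [::] = cst 0)//.
  by apply/funext => x; rewrite /window_sum big_nil.
rewrite (_ : window_sum (g :: F) = (w g \+ window_sum F)); last first.
  by apply/funext => x; rewrite /window_sum big_cons.
exact: measurable_funD.
Qed.

Lemma le_window_sum F g x : g \in F -> w g x <= window_sum F x.
Proof.
move=> gF; rewrite /window_sum (big_rem g)//= lerDl.
by apply: sumr_ge0.
Qed.

Lemma integral_window_sum F E : measurable E ->
  (\int[P]_(x in E) (window_sum F x)%:E = \sum_(g <- F) P (U g^-1%g @^-1` E))%E.
Proof.
move=> mE; under eq_integral do rewrite /window_sum -sumEFin.
rewrite ge0_integral_sum//; last 2 first.
- by move=> g; exact/measurable_EFinP/measurable_funTS.
- by move=> g x _; rewrite lee_fin.
by apply: eq_bigr => g _; rewrite (image_densityE (w_density g)).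
Qed.

(** A point [y], distributed with density the window sum, is seen as the origin
of the finite piece [{U g y, g in F}] of its orbit, from which two points [U u
y] and [U v y] are chosen independently, with probabilities proportional to [w
u y] and [w v y]. *)
Definition coupling_density (F : seq G) (u v : G) (x : W) : R :=
  w u x * w v x / window_sum F x.

Lemma coupling_density_ge0 F u v x : 0 <= coupling_density F u v x.
Proof. by rewrite /coupling_density divr_ge0 ?mulr_ge0 ?window_sum_ge0. Qed.

Lemma coupling_densityC F u v x : coupling_density F u v x = coupling_density F v u x.
Proof. by rewrite /coupling_density (mulrC (w u x)). Qed.

Lemma measurable_coupling_density F u v :
  measurable_fun [set: W] (coupling_density F u v).
Proof.
apply: measurable_funM; first exact: measurable_funM.
rewrite (_ : (fun x => _) = (@powR R ^~ (-1)) \o window_sum F); last first.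
  by apply/funext => x /=; rewrite powR_inv1// window_sum_ge0.
apply: measurableT_comp; [exact: measurable_powR|exact: measurable_window_sum].
Qed.

(** Where the window sum vanishes, so does [w u], and the convention [x / 0 =
0] gives the right value. *)
Lemma sum_coupling_density F u x : u \in F ->
  \sum_(v <- F) coupling_density F u v x = w u x.
Proof.
move=> uF; rewrite /coupling_density -mulr_suml -mulr_sumr -/(window_sum F x).
have [S0|S0] := eqVneq (window_sum F x) 0; last by rewrite mulfK.
have := le_window_sum x uF; rewrite S0 => wu0.
have /eqP -> : w u x == 0 by rewrite eq_le wu0 w0.
by rewrite !mul0r.
Qed.

Lemma coupling_density_le F u v x : v \in F -> coupling_density F u v x <= w u x.
Proof.
move=> vF; rewrite /coupling_density.
have [S0|S0] := eqVneq (window_sum F x) 0; first by rewrite S0 invr0 mulr0.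
rewrite -mulrA ler_piMr// ler_pdivrMr ?lt0r ?S0 ?window_sum_ge0//.
by rewrite mul1r le_window_sum.
Qed.

Definition coupling_mass (F : seq G) (u v : G) (E : set W) : R :=
  fine (\int[P]_(x in E) (coupling_density F u v x)%:E)%E.

Lemma coupling_massE F u v E : v \in F -> measurable E ->
  (coupling_mass F u v E)%:E = (\int[P]_(x in E) (coupling_density F u v x)%:E)%E.
Proof.
move=> vF mE; rewrite /coupling_mass fineK// ge0_fin_numE; last first.
  by apply: integral_ge0 => x _; rewrite lee_fin coupling_density_ge0.
apply: le_lt_trans (image_density_lty (w_density u) mE).
apply: ge0_le_integralEFin => //.
- exact: measurable_coupling_density.
- by move=> x; exact: coupling_density_ge0.
- by apply: aeW => x _; exact: coupling_density_le.
Qed.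

Lemma coupling_mass_ge0 F u v E : 0 <= coupling_mass F u v E.
Proof.
by apply: fine_ge0; apply: integral_ge0 => x _; rewrite lee_fin coupling_density_ge0.
Qed.

Lemma coupling_massC F u v E : coupling_mass F u v E = coupling_mass F v u E.
Proof.
by rewrite /coupling_mass; congr fine; apply: eq_integral => x _;
  rewrite coupling_densityC.
Qed.

Lemma le_coupling_mass F u v E E' : v \in F -> measurable E -> measurable E' ->
  E `<=` E' -> coupling_mass F u v E <= coupling_mass F u v E'.
Proof.
move=> vF mE mE' EE'; rewrite -lee_fin !coupling_massE//.
apply: ge0_subset_integral => //.
- exact/measurable_EFinP/measurable_funTS/measurable_coupling_density.
- by move=> x _; rewrite lee_fin coupling_density_ge0.
Qed.

Lemma coupling_massU F u v E E' : v \in F -> measurable E -> measurable E' ->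
  coupling_mass F u v (E `|` E') <= coupling_mass F u v E + coupling_mass F u v E'.
Proof.
move=> vF mE mE'; have mD : measurable (E' `\` E) by exact: measurableD.
rewrite -(_ : E `|` (E' `\` E) = E `|` E'); last by rewrite setDE setUIr setUCr setIT.
rewrite -lee_fin EFinD !coupling_massE//; last exact: measurableU.
rewrite ge0_integral_setU//; last 3 first.
- exact/measurable_EFinP/measurable_funTS/measurable_coupling_density.
- by move=> x _; rewrite lee_fin coupling_density_ge0.
- by apply/disj_set2P; rewrite setDIK.
apply: leeD => //; rewrite -!coupling_massE// lee_fin; exact: le_coupling_mass.
Qed.

(** The first marginal of the coupling: forgetting [v] gives back the translate
of [P] by [u]. *)
Lemma sum_coupling_mass F u E : u \in F -> measurable E ->
  \sum_(v <- F) coupling_mass F u v E = fine (P (U u^-1%g @^-1` E)).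
Proof.
move=> uF mE; apply: EFin_inj; rewrite fineK; last first.
  by apply: fin_num_measure; exact: measurable_preimage.
rewrite -sumEFin big_seq; under eq_bigr => v vF do rewrite coupling_massE//.
rewrite -big_seq -ge0_integral_sum//; last 2 first.
- by move=> v; exact/measurable_EFinP/measurable_funTS/measurable_coupling_density.
- by move=> v x _; rewrite lee_fin coupling_density_ge0.
rewrite (image_densityE (w_density u))//; apply: eq_integral => x _.
by rewrite sumEFin sum_coupling_density.
Qed.

(** From [a b <= a ^ 2 + b ^ 2]. *)
Lemma coupling_mass_le_diag F u v E : u \in F -> v \in F -> measurable E ->
  coupling_mass F u v E <= coupling_mass F u u setT + coupling_mass F v v setT.
Proof.
move=> uF vF mE; apply: (@le_trans _ _ (coupling_mass F u v setT)).
  exact: le_coupling_mass.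
rewrite -lee_fin EFinD !coupling_massE//.
have mc a b := measurable_coupling_density F a b.
rewrite -ge0_integralD//; last 4 first.
- by move=> x _; rewrite lee_fin coupling_density_ge0.
- exact/measurable_EFinP.
- by move=> x _; rewrite lee_fin coupling_density_ge0.
- exact/measurable_EFinP.
under [leRHS]eq_integral do rewrite -EFinD.
apply: ge0_le_integralEFin => //.
- exact: measurable_funD.
- by move=> x; exact: coupling_density_ge0.
- by move=> x; rewrite addr_ge0 ?coupling_density_ge0.
apply: aeW => x _; rewrite /coupling_density -mulrDl.
apply: ler_wpM2r; first by rewrite invr_ge0 window_sum_ge0.
have := sqr_ge0 (w u x - w v x); have := w0 u x; have := w0 v x; nra.
Qed.

End Coupling.

(** * Displacement of invariant sets: the main inequality *)

Lemma ae_forall_seq (R : realType) d (W : measurableType d)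
    (P : probability W R) (I : eqType) (s : seq I) (Q : I -> W -> Prop) :
  (forall i, i \in s -> {ae P, forall x, Q i x}) ->
  {ae P, forall x, forall i, i \in s -> Q i x}.
Proof.
elim: s => [|i s IH] H; first by apply: aeW => x i; rewrite in_nil.
have H1 := H i (mem_head _ _).
have H2 : {ae P, forall x, forall j, j \in s -> Q j x}.
  by apply: IH => j js; apply: H; rewrite in_cons js orbT.
apply: filterS2 H1 H2 => x ? H2 j; rewrite in_cons => /orP[/eqP ->//|].
exact: H2.
Qed.

Lemma le_sum_uniq_sub (R : realType) (I : eqType) (s r : seq I) (f : I -> \bar R) :
  uniq s -> {subset s <= r} -> (forall i, 0 <= f i)%E ->
  (\sum_(i <- s) f i <= \sum_(i <- r) f i)%E.
Proof.
move=> us sr f0; elim: s r us sr => [|i s IH] r /=.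
  by move=> _ _; rewrite big_nil; exact: sume_ge0.
move=> /andP[is_ us] sr; have ir : i \in r by apply: sr; rewrite mem_head.
rewrite big_cons [leRHS](big_rem i ir)/=; apply: leeD => //.
apply: IH => // j js; have := sr j; rewrite in_cons js orbT => /(_ isT).
rewrite (perm_mem (perm_to_rem ir)) in_cons => /orP[/eqP ji|//].
by move: is_; rewrite -ji js.
Qed.

Lemma sum_count_le (R : realType) (I J : choiceType) (s : seq I) (K : {fset J})
    (f : I -> J) (a : R) : uniq s -> injective f -> 0 <= a ->
  \sum_(i <- s) a *+ (f i \in K) <= #|` K|%:R * a.
Proof.
move=> us fI a0; rewrite sumrMnr -[leLHS]mulr_natl ler_wpM2r// ler_nat.
have -> : (\sum_(i <- s) (f i \in K) = count (fun i => f i \in K) s)%N.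
  by rewrite -sum1_count [RHS]big_mkcond; apply: eq_bigr => i _; case: ifP.
rewrite -size_filter -(size_map f); apply: uniq_leq_size.
  by rewrite map_inj_uniq// filter_uniq.
by move=> _ /mapP[i + ->]; rewrite mem_filter => /andP[].
Qed.

Section AsymptoticInvariance.
Context (R : realType) (G : groupType) d (W : measurableType d).
Variables (P : probability W R) (U : G -> W -> W).
Hypothesis U_action : borel_action U.

Let UM g h x : U (g * h)%g x = U g (U h x). Proof. by case: U_action. Qed.
Let U1 x : U 1%g x = x. Proof. by case: U_action. Qed.
Let mU g : measurable_fun [set: W] (U g). Proof. by case: U_action. Qed.
Let UK g x : U g^-1%g (U g x) = x. Proof. by rewrite -UM mulVg U1. Qed.
Let UKV g x : U g (U g^-1%g x) = x. Proof. by rewrite -UM mulgV U1. Qed.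

Definition conjugate (t : W -> W) (g : G) (x : W) : W := U g (t (U g^-1%g x)).

(** One constant serves for all the conjugates of [t]: for a change of one
coordinate this is what a uniform lower bound on the marginals provides. *)
Definition uniformly_quasi_invariant (C : R) (t : W -> W) : Prop :=
  involutive t /\ forall g, quasi_invariant P C (conjugate t g).

Lemma conjugate_involutive t g : involutive t -> involutive (conjugate t g).
Proof. by move=> tt x; rewrite /conjugate UK tt UKV. Qed.

(** This identity turns the effect of one conjugate of [t] on a translate of
[P] into the effect of another conjugate on [P] itself. *)
Lemma conjugateM t g h x : conjugate t g (U h x) = U h (conjugate t (h^-1 * g)%g x).
Proof. by rewrite /conjugate -!UM mulgA mulgV mul1g invgM invgK UM. Qed.

Variable w : G -> W -> R.
Hypothesis w_density : forall g, image_density P (U g^-1%g) (w g).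

Let mw g : measurable_fun [set: W] (w g). Proof. by case: (w_density g). Qed.
Let w0 g x : 0 <= w g x. Proof. by case: (w_density g). Qed.

(** The two factors [w u] and [w v] and the window sum each change by at most
[C ^ 2] along the conjugate of [t], and [P] contributes the seventh factor [C].
*)
Lemma coupling_mass_transport C t F u v E : uniformly_quasi_invariant C t -> 0 <= C ->
  u \in F -> v \in F -> measurable E ->
  coupling_mass P w F u v (conjugate t u^-1%g @^-1` E) <=
    C ^+ 7 * coupling_mass P w F u v E.
Proof.
move=> [tt tC] C0 uF vF mE.
set s := conjugate t u^-1%g.
have ss : involutive s by exact: conjugate_involutive.
have qs : quasi_invariant P C s by exact: tC.
have [ms _] := qs.
have ws : {ae P, forall x g, g \in F ->
    w g x <= C ^+ 2 * w g (s x) /\ w g (s x) <= C ^+ 2 * w g x}.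
  apply: ae_forall_seq => g _.
  apply: (image_density_quasi_invariant (w_density g) ss qs C0) => D mD.
  have -> : U g^-1%g @^-1` (s @^-1` D) =
      conjugate t (g * u^-1)%g @^-1` (U g^-1%g @^-1` D).
    by apply/seteqP; split=> x /=; rewrite /s conjugateM invgK.
  by have [_] := tC (g * u^-1)%g; apply; exact: measurable_preimage.
have hs : {ae P, forall x, coupling_density w F u v x <=
    C ^+ 6 * coupling_density w F u v (s x)}.
  apply: filterS ws => x ws; rewrite /coupling_density.
  have S0 := window_sum_ge0 w_density F.
  have S1 : window_sum w F x <= C ^+ 2 * window_sum w F (s x).
    rewrite /window_sum mulr_sumr big_seq [leRHS]big_seq.
    by apply: ler_sum => g gF; have [] := ws g gF.
  have S2 : window_sum w F (s x) <= C ^+ 2 * window_sum w F x.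
    rewrite /window_sum mulr_sumr big_seq [leRHS]big_seq.
    by apply: ler_sum => g gF; have [] := ws g gF.
  have [Z|Z] := eqVneq (window_sum w F x) 0.
    rewrite Z invr0 mulr0; apply: mulr_ge0; first exact: exprn_ge0.
    by rewrite divr_ge0 ?mulr_ge0.
  have pos : 0 < window_sum w F x by rewrite lt0r Z S0.
  have pos' : 0 < window_sum w F (s x).
    rewrite lt0r S0 andbT; apply/negP => /eqP Z'.
    by move: S1; rewrite Z' mulr0 leNgt pos.
  rewrite ler_pdivrMr//.
  have [wu _] := ws u uF; have [wv _] := ws v vF.
  apply: (@le_trans _ _ ((C ^+ 2 * w u (s x)) * (C ^+ 2 * w v (s x)))).
    by apply: ler_pM.
  have -> : C ^+ 6 * (w u (s x) * w v (s x) / window_sum w F (s x)) * window_sum w F x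
     = C ^+ 2 * w u (s x) * (C ^+ 2 * w v (s x)) * (C ^+ 2 * window_sum w F x / window_sum w F (s x)).
    by field; exact: lt0r_neq0.
  apply: ler_peMr; first by rewrite !mulr_ge0 ?exprn_ge0.
  by rewrite ler_pdivlMr// mul1r.
rewrite -lee_fin EFinM !(coupling_massE w_density)//; last exact: measurable_preimage.
rewrite exprSr; apply: transport_bound => //.
- exact: exprn_ge0.
- exact: (measurable_coupling_density w_density).
- by move=> x; exact: (coupling_density_ge0 w_density).
Qed.

(** Up to a set of measure at most [eta], the translates by [K] of every small
piece of the space have total measure at least [eta^-1] times that of the
piece; equivalently, [\sum_(g in K) w g] is almost everywhere at least [eta^-1]
outside that set. *)
Definition sweeping (eta : R) (K : seq G) (X0 : set W) : Prop :=
  [/\ measurable X0, (P (~` X0) <= eta%:E)%E &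
      forall E, measurable E -> E `<=` X0 ->
        (P E <= eta%:E * \sum_(g <- K) P (U g^-1%g @^-1` E))%E].

Lemma coupling_mass_diag_le1 F u : u \in F -> coupling_mass P w F u u setT <= 1.
Proof.
move=> uF; rewrite -lee_fin (coupling_massE w_density)//.
apply: (@le_trans _ _ (P (U u^-1%g @^-1` setT))); last by rewrite preimage_setT probability_setT.
rewrite (image_densityE (w_density u))//; apply: ge0_le_integralEFin => //.
- exact: (measurable_coupling_density w_density).
- by move=> x; exact: (coupling_density_ge0 w_density).
- by apply: aeW => x _; exact: (coupling_density_le w_density).
Qed.

(** Where the window contains [K u], sweeping applied at [U u y] shows that [w
u] is at most [eta] times the window sum, except on a set whose translate by
[u] has measure at most [eta]. *)
Lemma coupling_mass_diag_small eta K X0 F u : 0 <= eta -> sweeping eta K X0 ->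
  uniq K -> u \in F -> (forall g, g \in K -> (g * u)%g \in F) ->
  coupling_mass P w F u u setT <= 2 * eta.
Proof.
move=> eta0 [mX0 X0c X0E] uK uF KuF.
pose D := U u @^-1` X0.
have mD : measurable D by exact: measurable_preimage.
have wS : {ae P, forall x, D x -> w u x <= eta * window_sum w F x}.
  apply: ae_le_of_integral_le => //.
  - by apply: measurable_funM => //; exact: (measurable_window_sum w_density).
  - by move=> x; rewrite mulr_ge0 ?(window_sum_ge0 w_density).
  - exact: image_density_lty (w_density u) _.
  move=> E mE ED; rewrite -(image_densityE (w_density u))//.
  under [leRHS]eq_integral do rewrite EFinM.
  rewrite ge0_integralZl_EFin//; last 2 first.
  - by move=> x _; rewrite lee_fin (window_sum_ge0 w_density).
  - exact/measurable_EFinP/measurable_funTS/(measurable_window_sum w_density).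
  rewrite (integral_window_sum w_density)//.
  apply: le_trans (X0E _ (measurable_preimage (mU u^-1%g) mE) _) _.
    by move=> x /ED; rewrite /D /= UKV.
  apply: lee_wpmul2l; first by rewrite lee_fin.
  rewrite (eq_bigr (fun g => P (U (g * u)^-1%g @^-1` E))); last first.
    move=> g _; congr (P _); apply/seteqP; split=> x /=; rewrite invgM UM; done.
  rewrite -(big_map (fun g => g * u)%g predT (fun g => P (U g^-1%g @^-1` E))).
  apply: le_sum_uniq_sub => //.
  - by rewrite map_inj_uniq//; exact: mulIg.
  - by move=> _ /mapP[g gK ->]; exact: KuF.
have mc := measurable_coupling_density w_density F u u.
have c0 := coupling_density_ge0 w_density F u u.
have split_mass := coupling_massU w_density u uF mD (measurableC mD).
rewrite setUCr in split_mass.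
apply: (le_trans split_mass); rewrite mulr_natl mulr2n; apply: lerD.
  rewrite -lee_fin (coupling_massE w_density)//.
  apply: (@le_trans _ _ (\int[P]_(x in D) (eta * w u x)%:E)%E).
    apply: ge0_le_integralEFin => //.
    - exact: measurable_funM.
    - by move=> x; rewrite mulr_ge0.
    apply: filterS wS => x wS Dx; rewrite /coupling_density.
    have [Z|Z] := eqVneq (window_sum w F x) 0.
      by rewrite Z invr0 mulr0 mulr_ge0.
    rewrite ler_pdivrMr ?lt0r ?Z ?(window_sum_ge0 w_density)//.
    by rewrite mulrAC; apply: ler_wpM2r => //; exact: wS.
  under eq_integral do rewrite EFinM.
  rewrite ge0_integralZl_EFin//; last 2 first.
  - by move=> x _; rewrite lee_fin.
  - exact/measurable_EFinP/measurable_funTS.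
  rewrite -(image_densityE (w_density u))//.
  rewrite -[leRHS]mule1; apply: lee_wpmul2l; first by rewrite lee_fin.
  by apply: probability_le1; exact: measurable_preimage.
rewrite -lee_fin (coupling_massE w_density)//; last exact: measurableC.
apply: le_trans X0c.
apply: (@le_trans _ _ (\int[P]_(x in ~` D) (w u x)%:E)%E).
  apply: ge0_le_integralEFin => //; first exact: measurableC.
  by apply: aeW => x _; exact: (coupling_density_le w_density).
rewrite -(image_densityE (w_density u)); last exact: measurableC.
by rewrite (_ : _ @^-1` (~` D) = ~` X0)//; apply/seteqP; split=> x /=; rewrite /D /= UKV.
Qed.

(** For [g = v u^-1] outside [K], a point of the translate of [t^-1 B \ B] is
charged to the symmetric difference of [L] and [B], either directly or after
the conjugate of [t]; the couplings of the remaining pairs are bounded by their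
diagonal masses. *)
Lemma displacement_le C t F (K : {fset G}) (B L : set W) :
  uniformly_quasi_invariant C t -> 0 <= C -> uniq F ->
  measurable B -> measurable L -> (forall g, U g @^-1` B = B) ->
  (forall g, g \notin K -> forall x, L (U g (t x)) <-> L (U g x)) ->
  (size F)%:R * fine (P (t @^-1` B `\` B)) <=
    (1 + C ^+ 7) * (size F)%:R * fine (P ((L `\` B) `|` (B `\` L))) +
    2 * #|` K|%:R * \sum_(u <- F) coupling_mass P w F u u setT.
Proof.
move=> qt C0 uF mB mL BU LK.
have [tt tC] := qt.
have mt : measurable_fun [set: W] t.
  have [+ _] := tC 1%g; congr (measurable_fun _ _); apply/funext => x.
  by rewrite /conjugate invg1 !U1.
pose N := t @^-1` B `\` B.
pose D := (L `\` B) `|` (B `\` L).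
have mN : measurable N by apply: measurableD => //; exact: measurable_preimage.
have mD : measurable D by apply: measurableU; exact: measurableD.
pose m u v E := coupling_mass P w F u v E.
have BUE g x : B (U g x) <-> B x by rewrite -[X in _ <-> X x](BU g).
have step u v : u \in F -> v \in F ->
    m u v (U u @^-1` N) <= (1 + C ^+ 7) * m u v (U v @^-1` D) +
      (m u u setT + m v v setT) *+ ((v * u^-1)%g \in K).
  move=> uF' vF'.
  have mUN : measurable (U u @^-1` N) by exact: measurable_preimage.
  have mUD : measurable (U v @^-1` D) by exact: measurable_preimage.
  have [vuK|vuK] := boolP ((v * u^-1)%g \in K).
    rewrite mulr1n -[leLHS]add0r; apply: lerD.
      apply: mulr_ge0; last exact: (coupling_mass_ge0 w_density).
      by rewrite addr_ge0// exprn_ge0.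
    exact: (coupling_mass_le_diag w_density).
  rewrite mulr0n addr0 mulrDl mul1r.
  have mcUD : measurable (conjugate t u^-1%g @^-1` (U v @^-1` D)).
    by apply: measurable_preimage => //; have [] := tC u^-1%g.
  apply: le_trans (lerD (lexx _) (coupling_mass_transport qt C0 uF' vF' mUD)).
  apply: le_trans (coupling_massU w_density u vF' mUD mcUD).
  apply: (le_coupling_mass w_density) => //; first exact: measurableU.
  move=> x [/= Bt nB].
  have nBv : ~ B (U v x) by move/BUE; rewrite -(BUE u).
  have tE : U v (conjugate t u^-1%g x) = U (v * u^-1)%g (t (U u x)).
    by rewrite /conjugate invgK UM.
  have BvT : B (U v (conjugate t u^-1%g x)) by rewrite tE; apply/BUE.
  (* [B] separates the two points and [L] does not *)
  have [Lx|Lx] := pselect (L (U v x)); first by left; left.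
  right; right; split=> //; rewrite tE; move=> Lt.
  by apply: Lx; move/(LK _ vuK) : Lt; rewrite -UM mulgVK.
have -> : (size F)%:R * fine (P N) = \sum_(u <- F) \sum_(v <- F) m u v (U u @^-1` N).
  transitivity (\sum_(u <- F) fine (P N)).
    by rewrite big_const_seq count_predT iter_addr_0 mulr_natl.
  apply: eq_big_seq => u uF'.
  rewrite (sum_coupling_mass U_action w_density)//; last exact: measurable_preimage.
  congr (fine (P _)); apply/seteqP; split=> x /=; rewrite UKV//.
apply: (@le_trans _ _ (\sum_(u <- F) \sum_(v <- F)
    ((1 + C ^+ 7) * m u v (U v @^-1` D) +
      (m u u setT + m v v setT) *+ ((v * u^-1)%g \in K)))).
  rewrite big_seq [leRHS]big_seq; apply: ler_sum => u uF'.
  by rewrite big_seq [leRHS]big_seq; apply: ler_sum => v vF'; exact: step.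
under eq_bigr do rewrite big_split/=.
rewrite big_split/=; apply: lerD.
  rewrite exchange_big/=.
  have -> : (1 + C ^+ 7) * (size F)%:R * fine (P D) =
      \sum_(v <- F) (1 + C ^+ 7) * fine (P D).
    by rewrite big_const_seq count_predT iter_addr_0 -[RHS]mulr_natr mulrAC.
  rewrite le_eqVlt; apply/orP; left; apply/eqP; apply: eq_big_seq => v vF'.
  rewrite -mulr_sumr; congr (_ * _).
  under eq_bigr do rewrite /m coupling_massC.
  rewrite (sum_coupling_mass U_action w_density)//; last exact: measurable_preimage.
  congr (fine (P _)); apply/seteqP; split=> x /=; rewrite UKV//.
under eq_bigr do (under eq_bigr do rewrite mulrnDl; rewrite big_split/=).
rewrite big_split/= -mulrA mulr_natl mulr2n; apply: lerD.
  rewrite mulr_sumr; apply: ler_sum => u _.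
  by apply: sum_count_le => //; [exact: mulIg|exact: (coupling_mass_ge0 w_density)].
rewrite exchange_big/= mulr_sumr; apply: ler_sum => u _.
apply: (@sum_count_le _ _ _ F K (fun v => u * v^-1)%g) => //.
  by move=> x y /mulgI/invg_inj.
exact: (coupling_mass_ge0 w_density).
Qed.

End AsymptoticInvariance.

(** * Folner sets and the vanishing of the displacement *)

Lemma folner_set (R : realType) (G : groupType) (K : seq G) (eta : R) :
  amenable R G -> 0 < eta ->
  exists2 F : {fset G}, F != fset0 &
    \sum_(g <- K) #|` fsymdiff (translate g F) F|%:R <= eta * #|` F|%:R.
Proof.
move=> [F [F0 Fcvg]] eta0.
suff [n _ /(_ n (leqnn n)) H] : \forall n \near \oo,
    \sum_(g <- K) (#|` fsymdiff (translate g (F n)) (F n)|%:R / #|` F n|%:R) <= eta.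
  exists (F n) => //; rewrite -ler_pdivrMr ?mulr_suml// ltr0n cardfs_gt0//.
elim: K eta eta0 => [|g K IH] eta eta0.
  by apply: nearW => n; rewrite big_nil ltW.
have eta2 : 0 < eta / 2 by rewrite divr_gt0.
have H1 := IH _ eta2; have /cvgr0Pnorm_le/(_ _ eta2) H2 := Fcvg g.
apply: filterS2 H1 H2 => n H1 H2; rewrite big_cons (splitr eta) lerD//.
exact: le_trans (ler_norm _) H2.
Qed.

Section DisplacementNull.
Context (R : realType) (G : groupType) d (W : measurableType d).
Variables (P : probability W R) (U : G -> W -> W).
Hypothesis U_action : borel_action U.
Hypothesis U_null : forall g E, measurable E -> P E = 0%E -> P (U g @^-1` E) = 0%E.
Hypothesis G_amenable : amenable R G.
Hypothesis U_sweeping : forall eta : R, 0 < eta ->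
  exists K X0, uniq K /\ sweeping P U eta K X0.

Definition eventually_insensitive (t : W -> W) (L : set W) : Prop :=
  exists K : {fset G}, forall g, g \notin K -> forall x, L (U g (t x)) <-> L (U g x).

Definition approximable (A : set (set W)) (B : set W) : Prop :=
  forall e : R, 0 < e -> exists2 L, A L &
    measurable L /\ (P ((L `\` B) `|` (B `\` L)) <= e%:E)%E.

(** Each error term of [displacement_le] is made at most [e / 2] times [|F|]:
first [L] is chosen close to [B], which fixes [K], then [eta] small with
respect to [K], then the sweeping set [K0], and at last a Folner set [F] for
[K0]. *)
Lemma displacement_null C t B :
  uniformly_quasi_invariant P U C t -> 0 <= C -> measurable B ->
  (forall g, U g @^-1` B = B) -> approximable (eventually_insensitive t) B ->
  P (t @^-1` B `\` B) = 0%E.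
Proof.
move=> qt C0 mB BU Bapprox.
have [w w_density] := choice (fun g => exists_image_density
   (let: And3 _ _ H := U_action in H g^-1%g) (U_null g^-1%g)).
have mt : measurable_fun [set: W] t.
  have [_ /(_ 1%g)[+ _]] := qt; congr (measurable_fun _ _); apply/funext => x.
  by case: U_action => U1 _ _; rewrite /conjugate invg1 !U1.
have mN : measurable (t @^-1` B `\` B).
  by apply: measurableD => //; exact: measurable_preimage.
apply/eqP; rewrite eq_le measure_ge0 andbT -(fineK (fin_num_measure P _ mN)) lee_fin.
apply/ler_addgt0Pr => e e0; rewrite add0r.
set p := fine _.
have C1 : 0 < 1 + C ^+ 7 by rewrite ltr_pwDl// exprn_ge0.
pose e1 := e / 2 / (1 + C ^+ 7).
have e10 : 0 < e1 by rewrite !divr_gt0.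
have [L [K LK] [mL LB]] := Bapprox _ e10.
pose k : R := #|` K|%:R.
have k0 : 0 <= k by rewrite /k.
(* [6 k] bounds the coefficient of [eta]: [2 k] for the number of exceptional pairs, times
   [2 eta] from sweeping and [eta] from the Folner condition; [+ 1] avoids a zero divisor *)
pose eta := e / 2 / (6 * k + 1).
have k1 : 0 < 6 * k + 1 by rewrite ltr_wpDl ?mulr_ge0.
have eta0 : 0 < eta by rewrite !divr_gt0.
have [K0 [X0 [uK0 sK0]]] := U_sweeping eta0.
have [F Fn0 FK0] := folner_set K0 G_amenable eta0.
have F0 : 0 < #|` F|%:R :> R by rewrite ltr0n cardfs_gt0.
have := displacement_le U_action w_density qt C0 (fset_uniq F) mB mL BU LK.
rewrite -/p -/k.
set D := (L `\` B) `|` (B `\` L); set s := \sum_(u <- F) _.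
have sE : s <= (3 * eta) * #|` F|%:R.
  apply: (@le_trans _ _ (\sum_(u <- F) (2 * eta + \sum_(g <- K0)
     (1 : R) *+ ((g * u)%g \in fsymdiff (translate g F) F)))).
    rewrite /s big_seq [leRHS]big_seq; apply: ler_sum => u uF.
    have [/allP KF|/allPn[g gK gF]] := boolP (all (fun g => (g * u)%g \in F) K0).
      apply: (@le_trans _ _ (2 * eta)); last by rewrite lerDl sumr_ge0.
      by apply: (coupling_mass_diag_small U_action w_density) sK0 _ _ _ => //; exact: ltW.
    apply: (le_trans (coupling_mass_diag_le1 w_density uF)).
    have gS : (g * u)%g \in fsymdiff (translate g F) F.
      rewrite /fsymdiff !inE gF andTb; apply/orP; left.
      by apply/imfsetP; exists u.
    rewrite (big_rem g gK)/= gS.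
    set r := (X in _ + (_ + X)); have r0 : 0 <= r by exact: sumr_ge0.
    by rewrite mulr1n; lra.
  rewrite big_split/= big_const_seq count_predT iter_addr_0.
  rewrite -[X in X + _]mulr_natr.
  suff : \sum_(u <- F) \sum_(g <- K0)
     (1 : R) *+ ((g * u)%g \in fsymdiff (translate g F) F) <= eta * #|` F|%:R.
    by move: (_ *+ _) => z; nra.
  rewrite exchange_big/=; apply: le_trans FK0; apply: ler_sum => g _.
  rewrite -[leRHS]mulr1; apply: sum_count_le => //.
  by move=> x y /mulgI.
have DE : fine (P D) <= e1.
  by rewrite -lee_fin fineK// fin_num_measure//; apply: measurableU; exact: measurableD.
have e1E : (1 + C ^+ 7) * e1 = e / 2 by rewrite /e1 mulrC divfK ?gt_eqF.
have etaE : (6 * k + 1) * eta = e / 2 by rewrite /eta mulrC divfK ?gt_eqF.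
move=> main; rewrite -(ler_pM2l F0); apply: (le_trans main).
have H1 : (1 + C ^+ 7) * #|` F|%:R * fine (P D) <= e / 2 * #|` F|%:R.
  by rewrite -e1E mulrAC ler_wpM2r// ler_wpM2l// ltW.
have H2 : 2 * k * s <= e / 2 * #|` F|%:R.
  rewrite -etaE; apply: le_trans (ler_wpM2l _ sE) _; first by rewrite mulr_ge0.
  by rewrite mulrA ler_wpM2r//; lra.
by apply: (le_trans (lerD H1 H2)); rewrite -mulrDl -splitr mulrC.
Qed.

End DisplacementNull.

(** * Conservative actions sweep the space *)

Lemma countable_infinite_enum (T : Type) :
  countable [set: T] -> infinite_set [set: T] ->
  exists (e : nat -> T) (f : T -> nat), cancel e f /\ cancel f e.
Proof.
move=> cT /infiniteP iT; have /card_set_bijP[f [_ fI fS]] : ([set: T] #= [set: nat])%card.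
  by apply/card_eqPle.
have /choice[e efK] : forall n, exists x, f x = n.
  by move=> n; have [x _ fx] := fS n I; exists x.
by exists e, f; split=> // x; apply: fI; rewrite ?in_setT.
Qed.

Section Sweeping.
Context (R : realType) (G : groupType) d (Y : measurableType d).
Variables (nu : probability Y R) (Q : G -> Y -> Y).
Hypothesis Q_action : borel_action Q.

Let QM g h x : Q (g * h)%g x = Q g (Q h x). Proof. by case: Q_action. Qed.
Let Q1 x : Q 1%g x = x. Proof. by case: Q_action. Qed.
Let mQ g : measurable_fun [set: Y] (Q g). Proof. by case: Q_action. Qed.
Let QK g x : Q g^-1%g (Q g x) = x. Proof. by rewrite -QM mulVg Q1. Qed.
Let QKV g x : Q g (Q g^-1%g x) = x. Proof. by rewrite -QM mulgV Q1. Qed.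

Lemma action_imageE g (B : set Y) : Q g @` B = Q g^-1%g @^-1` B.
Proof.
apply/seteqP; split=> [_ [x Bx <-]|x Bx] /=; first by rewrite QK.
by exists (Q g^-1%g x) => //; rewrite QKV.
Qed.

Lemma nonsingular_preimage g E : nonsingular nu Q -> measurable E ->
  nu (Q g @^-1` E) = 0%E <-> nu E = 0%E.
Proof. by move=> ns mE; rewrite -{1}(invgK g) -action_imageE; exact: ns. Qed.

(** If the sums of the densities over larger and larger finite sets stayed
bounded on a set [B] of positive measure, the measures of the translates of [B]
would be summable; by Borel-Cantelli almost every point would return to [B]
finitely often, against conservativity. *)
Lemma conservative_sweeping (eta : R) :
  countable [set: G] -> infinite_set [set: G] ->
  nonsingular nu Q -> conservative nu Q -> 0 < eta ->
  exists K X0, uniq K /\ sweeping nu Q eta K X0.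
Proof.
move=> cG iG ns cons eta0.
have [e [f [eK fK]]] := countable_infinite_enum cG iG.
have [w w_density] := choice (fun g => exists_image_density (mQ g^-1%g)
   (fun E mE => proj2 (nonsingular_preimage g^-1%g ns mE))).
pose K n := [seq e i | i <- iota 0 n].
have uK n : uniq (K n) by rewrite map_inj_uniq ?iota_uniq//; exact: can_inj eK.
have sumK n (a : G -> \bar R) : (\sum_(g <- K n) a g = \sum_(0 <= i < n) a (e i))%E.
  by rewrite big_map /index_iota subn0.
have w0 := window_sum_ge0 w_density.
have mS := measurable_window_sum w_density.
have Smono n m x : (n <= m)%N -> window_sum w (K n) x <= window_sum w (K m) x.
  move=> nm; rewrite -(subnKC nm) /K iotaD map_cat /window_sum big_cat/= lerDl.
  by apply: sumr_ge0 => g _; case: (w_density g).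
pose A n := [set x | window_sum w (K n) x < eta^-1].
have mA n : measurable (A n).
  have -> : A n = (fun x => window_sum w (K n) x < eta^-1) @^-1` [set true].
    by apply/seteqP; split=> x /=.
  by apply: measurable_preimage => //; exact: measurable_fun_ltr.
pose B := \bigcap_n A n.
have mB : measurable B by exact: bigcapT_measurable.
(* [B] is where the sums stay below [eta^-1] forever *)
have B0 : nu B = 0%E.
  apply/eqP; rewrite eq_le measure_ge0 andbT leNgt; apply/negP => Bpos.
  pose F i := Q (e i)^-1%g @^-1` B.
  have mF i : measurable (F i) by exact: measurable_preimage.
  have F_lty : (\sum_(0 <= i <oo) nu (F i) < +oo)%E.
    apply: (@le_lt_trans _ _ (eta^-1)%:E); last exact: ltry.
    apply: lime_le; first by apply: is_cvg_nneseries.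
    apply: nearW => n.
    rewrite -(sumK n (fun g => nu (Q g^-1%g @^-1` B))) -(integral_window_sum w_density)//.
    apply: (@le_trans _ _ (\int[nu]_(x in B) (cst (eta^-1) x)%:E)%E).
      apply: ge0_le_integralEFin => //; first by move=> x /=; rewrite invr_ge0 ltW.
      by apply: aeW => x /(_ n I) /ltW.
    rewrite (integral_cst nu mB (eta^-1)%:E) -[leRHS]mule1 lee_wpmul2l ?lee_fin ?invr_ge0 ?(ltW eta0)//.
    exact: probability_le1.
  have limsup0 := lim_sup_set_cvg0 mF F_lty.
  have mlim : measurable (lim_sup_set F).
    by apply: bigcapT_measurable => n; apply: bigcup_measurable.
  have [N [mN N0 BN]] := cons B mB Bpos.
  suff : nu B = 0%E by move: Bpos => /[swap] ->; rewrite ltxx.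
  have sub : B `<=` N `|` lim_sup_set F.
    move=> x Bx; have [|nlim] := pselect (lim_sup_set F x); first by right.
    left; apply: BN => /= /(_ Bx); apply.
    have [n nF] : exists n, forall i, (n <= i)%N -> ~ F i x.
      apply: contrapT => H; apply: nlim => n _; apply: contrapT => H'.
      by apply: H; exists n => i ni Fi; apply: H'; exists i.
    apply: (@sub_finite_set _ _ ((fun i => (e i)^-1%g) @` `I_n)); last first.
      exact: finite_image.
    move=> g /= Bg; exists (f g^-1%g); last by rewrite fK invgK.
    rewrite /= ltnNge; apply/negP => /nF; apply.
    by rewrite /F /= fK invgK.
  apply: (subset_measure0 _ _ sub) => //; first exact: measurableU.
  exact: etrans (measureU0 mN mlim limsup0) N0.
have ndA : nonincreasing_seq A.
  by move=> n m nm; apply/subsetPset => x; apply: le_lt_trans; exact: Smono.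
have cvgA : nu (A n) @[n --> \oo] --> 0%E.
  rewrite -B0; apply: nonincreasing_cvg_mu => //.
  exact: le_lt_trans (probability_le1 _ (mA 0%N)) (ltry _).
have [n nA] : exists n, (nu (A n) <= eta%:E)%E.
  have /fine_cvgP[_ /cvgr0Pnorm_le/(_ _ eta0)[n _ /(_ n (leqnn n)) /= H]] := cvgA.
  exists n; rewrite -(fineK (fin_num_measure nu _ (mA n))) lee_fin.
  exact: le_trans (ler_norm _) H.
exists (K n), (~` A n); split=> //; split; first exact: measurableC.
  by rewrite setCK.
move=> E mE EA; rewrite -(integral_window_sum w_density)// -ge0_integralZl_EFin//; last 3 first.
- by move=> x _; rewrite lee_fin.
- exact/measurable_EFinP/measurable_funTS.
- exact: ltW.
rewrite -[leLHS]mul1e -integral_cst//.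
under [leRHS]eq_integral do rewrite -EFinM.
apply: (@ge0_le_integralEFin _ _ _ _ (cst 1)) => //.
- exact: measurable_funM.
- by move=> x; rewrite mulr_ge0// ltW.
apply: aeW => x /EA /negP; rewrite -leNgt => H /=.
by rewrite -(mulfV (lt0r_neq0 eta0)) ler_wpM2l// ltW.
Qed.

End Sweeping.

(** * Products with a measure preserving action *)

Section ProductProbability.
Context (R : realType) d (Y : measurableType d) d' (Z : measurableType d').
Variables (nu : probability Y R) (la : probability Z R).

Let product_function : set (Y * Z) -> \bar R := (nu \x la)%E.

HB.instance Definition _ := Measure.on product_function.

Let product_function_setT : product_function setT = 1%E.
Proof.
rewrite /product_function -setXTT; transitivity (nu setT * la setT)%E.
  exact: product_measure1E.
by rewrite !probability_setT mule1.
Qed.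

HB.instance Definition _ := Measure_isProbability.Build _ _ _
  product_function product_function_setT.

Definition product_probability : probability (Y * Z)%type R := product_function.

Lemma product_probability_measure E : product_probability E = (nu \x la)%E E.
Proof. by []. Qed.

Definition slice (E : set (Y * Z)) (z : Z) : set Y := [set y | E (y, z)].

Lemma sliceE E z : slice E z = ysection E z.
Proof. by rewrite ysectionE. Qed.

Lemma measurable_slice E z : measurable E -> measurable (slice E z).
Proof. by rewrite sliceE; exact: measurable_ysection. Qed.

Lemma measurable_fun_slice (m : probability Y R) E : measurable E ->
  measurable_fun [set: Z] (fun z => m (slice E z)).
Proof.
move=> mE; rewrite (_ : (fun z => _) = m \o ysection E).
  exact: measurable_fun_ysection.
by apply/funext => z /=; rewrite sliceE.
Qed.

Lemma product_probabilityE E : measurable E ->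
  product_probability E = (\int[la]_z nu (slice E z))%E.
Proof.
move=> mE; have := indic_fubini_tonelli nu la mE.
rewrite indic_fubini_tonelli_FE// indic_fubini_tonelli_GE// => H.
by rewrite product_probability_measure /product_measure1 H; apply: eq_integral => z _;
  rewrite /= sliceE.
Qed.

Lemma product_probability_eq0 E : measurable E ->
  product_probability E = 0%E <-> {ae la, forall z, nu (slice E z) = 0%E}.
Proof.
move=> mE; rewrite product_probabilityE//.
have := @ae_eq_integral_abs _ _ _ la _ measurableT _ (measurable_fun_slice nu mE).
under eq_integral do rewrite gee0_abs//.
by move=> ->; split; apply: filterS => z; [apply|].
Qed.

End ProductProbability.

Section ProductAction.
Context (R : realType) (G : groupType) d (Y : measurableType d).
Context d' (Z : measurableType d').
Variables (nu : probability Y R) (la : probability Z R).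
Variables (Q : G -> Y -> Y) (S : G -> Z -> Z).
Hypotheses (Q_action : borel_action Q) (S_action : borel_action S).
Hypothesis S_mp : measure_preserving la S.

Let mQ g : measurable_fun [set: Y] (Q g). Proof. by case: Q_action. Qed.
Let mS g : measurable_fun [set: Z] (S g). Proof. by case: S_action. Qed.

Definition product_action (g : G) (yz : Y * Z) : Y * Z := (Q g yz.1, S g yz.2).

Local Notation kappa := (product_probability nu la).
Local Notation U := product_action.

Lemma measurable_product_map (s : Y -> Y) (r : Z -> Z) :
  measurable_fun [set: Y] s -> measurable_fun [set: Z] r ->
  measurable_fun [set: Y * Z] (fun yz => (s yz.1, r yz.2)).
Proof.
move=> ms mr; apply: measurable_fun_pair.
  by apply: measurableT_comp ms _; exact: measurable_fst.
by apply: measurableT_comp mr _; exact: measurable_snd.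
Qed.

Lemma product_action_borel : borel_action U.
Proof.
case: Q_action S_action => Q1 QM _ [S1 SM _]; split.
- by move=> [y z]; rewrite /U /= Q1 S1.
- by move=> g h [y z]; rewrite /U /= QM SM.
- by move=> g; exact: measurable_product_map.
Qed.

(** As [S g] preserves [la], the slices may be moved by [Q g] alone. *)
Lemma product_action_preimage g E : measurable E ->
  kappa (U g @^-1` E) = (\int[la]_z nu (Q g @^-1` (slice E z)))%E.
Proof.
move=> mE; rewrite product_probabilityE; last first.
  by apply: measurable_preimage => //; case: product_action_borel.
pose phi z := image_probability nu (mQ g) (slice E z).
have mphi : measurable_fun [set: Z] phi by exact: measurable_fun_slice.
transitivity (\int[la]_(z in S g @^-1` setT) phi (S g z))%E.
  by rewrite preimage_setT; apply: eq_integral.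
rewrite -(integral_image_probability la (mS g) measurableT mphi)//.
by apply: eq_measure_integral => A mA _; exact: S_mp.
Qed.

Lemma product_action_null g E : nonsingular nu Q -> measurable E ->
  kappa E = 0%E -> kappa (U g @^-1` E) = 0%E.
Proof.
move=> ns mE /(product_probability_eq0 _ _ mE) E0.
rewrite product_action_preimage// (ae_eq_integral (cst 0%E))//.
- by rewrite integral0.
- exact: (measurable_fun_slice (image_probability nu (mQ g))).
- apply: filterS E0 => z /= E0 _.
  by apply/nonsingular_preimage => //; exact: measurable_slice.
Qed.

(** Sweeping is an inequality between measures of sets, so it may be checked
slice by slice and integrated. *)
Lemma product_action_sweeping eta K X0 : 0 <= eta ->
  sweeping nu Q eta K X0 -> sweeping kappa U eta K (X0 `*` setT).
Proof.
move=> eta0 [mX0 X0c X0E]; split; first exact: measurableX.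
  rewrite (_ : ~` _ = (~` X0) `*` setT); last first.
    by apply/seteqP; split=> -[y z] /=; tauto.
  apply: le_trans X0c; rewrite le_eqVlt; apply/orP; left; apply/eqP.
  transitivity (nu (~` X0) * la setT)%E; last by rewrite probability_setT mule1.
  by apply: product_measure1E => //; exact: measurableC.
move=> E mE EX0; rewrite product_probabilityE//.
have mQE g : measurable_fun [set: Z] (fun z => nu (Q g @^-1` slice E z)).
  exact: (measurable_fun_slice (image_probability nu (mQ g))).
rewrite (eq_bigr (fun g => \int[la]_z nu (Q g^-1%g @^-1` slice E z))%E); last first.
  by move=> g _; exact: product_action_preimage.
rewrite -ge0_integral_sum// -ge0_integralZl//; last 2 first.
- exact: emeasurable_sum.
- by move=> z _; exact: sume_ge0.
apply: ge0_le_integral => //.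
- exact: measurable_fun_slice.
- by apply: emeasurable_funM => //; exact: emeasurable_sum.
- move=> z _; apply: X0E; first exact: measurable_slice.
  by move=> y /EX0[].
Qed.

Definition lift_map (t : Y -> Y) (yz : Y * Z) : Y * Z := (t yz.1, yz.2).

(** The second factor cancels in the conjugates of [lift_map t]. *)
Lemma lift_map_uniformly_quasi_invariant C t :
  0 <= C ->
  uniformly_quasi_invariant nu Q C t -> uniformly_quasi_invariant kappa U C (lift_map t).
Proof.
move=> C0 [tt tC]; split; first by move=> [y z]; rewrite /lift_map /= tt.
move=> g.
have S1 z : S g (S g^-1%g z) = z.
  by case: S_action => S1 SM _; rewrite -SM mulgV S1.
have cE : conjugate U (lift_map t) g = lift_map (conjugate Q t g).
  by apply/funext => -[y z]; rewrite /conjugate /lift_map /U /= S1.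
rewrite cE; have [mc cC] := tC g.
have mlc : measurable_fun [set: Y * Z] (lift_map (conjugate Q t g)).
  exact: (@measurable_product_map _ id).
split => // E mE.
rewrite !product_probabilityE//; last exact: measurable_preimage.
rewrite -ge0_integralZl//; last exact: measurable_fun_slice.
apply: ge0_le_integral => //.
- by apply: (measurable_fun_slice nu); exact: measurable_preimage.
- by apply: emeasurable_funM => //; exact: measurable_fun_slice.
- by move=> z _; apply: cC; exact: measurable_slice.
Qed.

Lemma slice_displacement_null C t B :
  countable [set: G] -> infinite_set [set: G] -> amenable R G ->
  nonsingular nu Q -> conservative nu Q ->
  uniformly_quasi_invariant nu Q C t -> 0 <= C ->
  measurable B -> (forall g, U g @^-1` B = B) ->
  approximable kappa (eventually_insensitive U (lift_map t)) B ->
  {ae la, forall z, nu (t @^-1` slice B z `\` slice B z) = 0%E}.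
Proof.
move=> cG iG aG ns cons qt C0 mB BU Bapprox.
have qlt := lift_map_uniformly_quasi_invariant C0 qt.
have mt : measurable_fun [set: Y * Z] (lift_map t).
  have [_ /(_ 1%g)[+ _]] := qlt; congr (measurable_fun _ _); apply/funext => x.
  by case: product_action_borel => U1 _ _; rewrite /conjugate invg1 !U1.
suff : kappa (lift_map t @^-1` B `\` B) = 0%E.
  by move/product_probability_eq0; apply; apply: measurableD => //; exact: measurable_preimage.
apply: (displacement_null product_action_borel _ aG _ qlt C0 mB BU Bapprox).
  by move=> g E; exact: product_action_null.
move=> eta eta0.
have [K [X0 [uK sK]]] := conservative_sweeping Q_action cG iG ns cons eta0.
by exists K, (X0 `*` setT); split=> //; apply: product_action_sweeping => //; exact: ltW.
Qed.

End ProductAction.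

(** * Approximation by an algebra of sets *)

Section Approximation.
Context (R : realType) d (W : measurableType d) (P : probability W R).
Variable A : set (set W).
Hypotheses (A0 : A set0) (AC : forall L, A L -> A (~` L)).
Hypothesis AU : forall L M, A L -> A M -> A (L `|` M).

Definition symdiff (X X' : set W) : set W := (X `\` X') `|` (X' `\` X).

Let measurable_symdiff X X' : measurable X -> measurable X' ->
  measurable (symdiff X X').
Proof. by move=> mX mX'; apply: measurableU; exact: measurableD. Qed.

Let symdiff_le2 X X1 X2 (e1 e2 : R) :
  measurable X -> measurable X1 -> measurable X2 -> X `<=` X1 `|` X2 ->
  (P X1 <= e1%:E)%E -> (P X2 <= e2%:E)%E -> (P X <= (e1 + e2)%:E)%E.
Proof.
move=> mX mX1 mX2 sub P1 P2; apply: (@le_trans _ _ (P (X1 `|` X2))).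
  by rewrite le_measure// inE//; exact: measurableU.
by apply: (le_trans (measureU2 _ mX1 mX2)); rewrite EFinD leeD.
Qed.

Lemma approximableC B : approximable P A B -> approximable P A (~` B).
Proof.
move=> aB e e0; have [L AL [mL LB]] := aB e e0.
exists (~` L); first exact: AC.
split; first exact: measurableC.
rewrite (_ : _ `|` _ = (L `\` B) `|` (B `\` L))//.
by apply/seteqP; split=> x /=; have [|] := pselect (B x); have [|] := pselect (L x); tauto.
Qed.

Lemma approximableU B B' : measurable B -> measurable B' ->
  approximable P A B -> approximable P A B' -> approximable P A (B `|` B').
Proof.
move=> mB mB' aB aB' e e0; have e20 : 0 < e / 2 by rewrite divr_gt0.
have [L AL [mL LB]] := aB _ e20; have [L' AL' [mL' LB']] := aB' _ e20.
have mLL : measurable (L `|` L') by exact: measurableU.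
have mBB : measurable (B `|` B') by exact: measurableU.
exists (L `|` L'); [exact: AU | split => //]; rewrite (splitr e).
apply: (@symdiff_le2 _ (symdiff L B) (symdiff L' B')) => //; try exact: measurable_symdiff.
by move=> x; rewrite /symdiff /=; tauto.
Qed.

Lemma approximable_lim B : measurable B ->
  (forall e : R, 0 < e -> exists2 B', measurable B' /\ approximable P A B' &
    (P ((B' `\` B) `|` (B `\` B')) <= e%:E)%E) ->
  approximable P A B.
Proof.
move=> mB H e e0; have e20 : 0 < e / 2 by rewrite divr_gt0.
have [B' [mB' aB'] B'B] := H _ e20; have [L AL [mL LB]] := aB' _ e20.
exists L => //; split=> //; rewrite (splitr e).
apply: (@symdiff_le2 _ (symdiff L B') (symdiff B' B)) => //; try exact: measurable_symdiff.
by move=> x; rewrite /symdiff /=; have [|] := pselect (B' x); tauto.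
Qed.

(** A countable union is the limit in measure of its finite partial unions. *)
Lemma approximable_bigcup (F : nat -> set W) :
  (forall n, measurable (F n)) -> (forall n, approximable P A (F n)) ->
  approximable P A (\bigcup_n F n).
Proof.
move=> mF aF; have mU : measurable (\bigcup_n F n) by exact: bigcupT_measurable.
pose S n := \big[setU/set0]_(i < n) F i.
have mS n : measurable (S n) by exact: bigsetU_measurable.
have aS n : approximable P A (S n).
  elim: n => [|n IH]; rewrite /S; last first.
    by rewrite big_ord_recr /=; apply: approximableU => //; exact: mS.
  rewrite big_ord0 => e e0; exists set0 => //; split=> //.
  by rewrite setDv setU0 measure0 lee_fin ltW.
apply: approximable_lim => // e e0.
pose D n := (\bigcup_n F n) `\` S n.
have mD n : measurable (D n) by exact: measurableD.
have D0 : \bigcap_n D n = set0.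
  apply/seteqP; split=> x //= xD; have [[n _ Fx] _] := xD 0%N I.
  have [_] := xD n.+1 I; apply; rewrite /S -bigcup_mkord.
  by exists n => /=.
have ndD : nonincreasing_seq D.
  move=> n m nm; apply/subsetPset; apply: setDS.
  rewrite /S -!bigcup_mkord => x [i /= im Fx].
  by exists i => //=; exact: leq_trans nm.
have cvgD : P (D n) @[n --> \oo] --> 0%E.
  rewrite -(measure0 P) -D0; apply: nonincreasing_cvg_mu => //.
    exact: le_lt_trans (probability_le1 _ (mD 0%N)) (ltry _).
  by rewrite D0.
have /fine_cvgP[_ /cvgr0Pnorm_le/(_ _ e0)[n _ /(_ n (leqnn n)) /= H]] := cvgD.
exists (S n) => //.
rewrite (_ : _ `|` _ = D n).
  rewrite -(fineK (fin_num_measure P _ (mD n))) lee_fin.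
  exact: le_trans (ler_norm _) H.
rewrite /D [X in X `|` _](_ : _ = set0) ?set0U//.
apply/seteqP; split=> x //= []; rewrite /S -bigcup_mkord => -[i _ Fx]; apply.
by exists i.
Qed.

Lemma approximable_generated (Gs : set (set W)) :
  (measurable : set (set W)) = <<s Gs>> -> Gs `<=` approximable P A ->
  forall B, measurable B -> approximable P A B.
Proof.
move=> mE GsA B mB.
suff : <<s Gs>> `<=` [set X | measurable X /\ approximable P A X].
  by rewrite -mE => /(_ _ mB) [].
apply: smallest_sub; last first.
  by move=> X GX; split; [rewrite mE; exact: sub_sigma_algebra|exact: GsA].
split.
- split=> //; move=> e e0; exists set0 => //; split=> //.
  by rewrite setDv setU0 measure0 lee_fin ltW.
- move=> X [mX aX]; rewrite setTD.
  by split; [exact: measurableC|exact: approximableC].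
- move=> F mF; split; first by apply: bigcupT_measurable => n; case: (mF n).
  by apply: approximable_bigcup => n; case: (mF n).
Qed.

End Approximation.

(** * Independent coordinates and swaps of letters *)

Section Boxes.
Context (I : choiceType) (T : Type).
Implicit Types (B : I -> set T) (i : I) (s : seq I) (C : set T).

Definition replace_side B i C : I -> set T := fun j => if j == i then C else B j.

Definition supported_on s B : Prop := forall i, i \notin s -> B i = setT.

Lemma replace_sideE B i C : replace_side B i C i = C.
Proof. by rewrite /replace_side eqxx. Qed.

Lemma replace_sideK B i C C' :
  replace_side (replace_side B i C) i C' = replace_side B i C'.
Proof. by apply/funext => j; rewrite /replace_side; case: eqP. Qed.

Lemma supported_on_cons s i B C : supported_on s B ->
  supported_on (i :: s) (replace_side B i C).
Proof.
move=> sB j; rewrite in_cons negb_or /replace_side => /andP[/negbTE -> js].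
exact: sB.
Qed.

Lemma supported_onT s i B : supported_on (i :: s) B ->
  supported_on s (replace_side B i setT).
Proof.
move=> sB j js; rewrite /replace_side; case: eqVneq => // ji.
by apply: sB; rewrite in_cons negb_or ji.
Qed.

End Boxes.

Definition swap (T : eqType) (a b x : T) : T :=
  if x == a then b else if x == b then a else x.

Lemma swap_involutive (T : eqType) (a b : T) : involutive (swap a b).
Proof.
move=> x; rewrite /swap.
have [->|xa] := eqVneq x a; first by case: (eqVneq b a) => [->|]; rewrite ?eqxx.
by have [->|xb] := eqVneq x b; rewrite ?eqxx// (negbTE xa) (negbTE xb).
Qed.

Lemma swapR (T : eqType) (a b : T) : swap a b b = a.
Proof. by rewrite /swap eqxx; case: eqVneq. Qed.

Section Coordinates.
Context (R : realType) dA (A : measurableType dA) d (Y : measurableType d).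
Context (I : choiceType).

Definition box (c : Y -> I -> A) (B : I -> set A) : set Y :=
  [set y | forall i, B i (c y i)].

Definition coordinate_sets (c : Y -> I -> A) : set (set Y) :=
  [set (fun y => c y i) @^-1` C | i in [set: I] & C in measurable].

(** A description of [Y] as the space of all functions [I -> A], with inverse
bijections [c] and [mk], under which [nu] is a product measure. Independence is
stated as the possibility to factor out one side of a box at a time, the only
form in which it is used. It covers both the functions on a group and the
iterated functions on which the diagonal action lives. *)
Record independent_coordinates (nu : probability Y R)
    (marg : I -> probability A R) (c : Y -> I -> A) (mk : (I -> A) -> Y) : Prop := {
  coordinatesK : cancel mk c;
  of_coordinatesK : cancel c mk;
  coordinates_generate : (measurable : set (set Y)) = <<s coordinate_sets c>>;
  box_factor : forall s B i, supported_on s B -> (forall j, measurable (B j)) ->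
    nu (box c B) = (marg i (B i) * nu (box c (replace_side B i setT)))%E }.

Variables (nu : probability Y R) (marg : I -> probability A R).
Variables (c : Y -> I -> A) (mk : (I -> A) -> Y).
Hypothesis indep : independent_coordinates nu marg c mk.
Lemma measurable_coordinate i : measurable_fun [set: Y] (fun y => c y i).
Proof.
move=> _ C mC; rewrite setTI (coordinates_generate indep).
by apply: sub_sigma_algebra; exists i => //; exists C.
Qed.

Let measurable_side i C : measurable C -> measurable ((fun y => c y i) @^-1` C).
Proof. exact: measurable_preimage (measurable_coordinate i). Qed.

Lemma measurable_box s B : supported_on s B -> (forall i, measurable (B i)) ->
  measurable (box c B).
Proof.
move=> sB mB; rewrite (_ : box c B =
    \bigcap_(i in [set` s]) (fun y => c y i) @^-1` (B i)).
  by apply: fin_bigcap_measurable => // i _; exact: measurable_side.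
apply/seteqP; split=> y /= By i; first by move=> _; exact: By.
by have [si|/sB ->//] := boolP (i \in s); exact: By.
Qed.

Lemma box_split B i :
  box c B = (fun y => c y i) @^-1` (B i) `&` box c (replace_side B i setT).
Proof.
apply/seteqP; split=> [y By|y [/= Bi By] j]; first split=> // j.
  by rewrite /replace_side; case: eqP.
by have := By j; rewrite /replace_side; case: eqP => [->|].
Qed.

(** Boxes with finitely many nontrivial sides form a pi-system generating the
sigma-algebra. *)
Lemma box_measure_unique (m1 m2 : {measure set Y -> \bar R}) :
  (m1 setT < +oo)%E ->
  (forall s B, supported_on s B -> (forall i, measurable (B i)) ->
    m1 (box c B) = m2 (box c B)) ->
  forall E, measurable E -> m1 E = m2 E.
Proof.
move=> m1T m12 E mE.
pose Bx : set (set Y) := [set X | exists s B,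
  [/\ supported_on s B, (forall i, measurable (B i)) & X = box c B]].
have BxT : Bx setT.
  by exists [::], (fun=> setT); split=> //; apply/seteqP; split.
apply: (measure_unique Bx (fun=> setT)) => //.
- rewrite (coordinates_generate indep); apply/seteqP; split.
    apply: smallest_sub; first exact: smallest_sigma_algebra.
    move=> _ [i _ [C mC <-]]; apply: sub_sigma_algebra.
    exists [:: i], (replace_side (fun=> setT) i C); split.
    + by apply: supported_on_cons => j.
    + by move=> j; rewrite /replace_side; case: ifP.
    + apply/seteqP; split=> [y /= Cy j|y /(_ i)]; last by rewrite replace_sideE.
      by rewrite /replace_side; case: eqP => // ->.
  apply: smallest_sub; first exact: smallest_sigma_algebra.
  move=> _ [s [B [sB mB ->]]]; have := measurable_box sB mB.
  by rewrite (coordinates_generate indep).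
- move=> _ _ [s [B [sB mB ->]]] [s' [B' [sB' mB' ->]]].
  exists (s ++ s'), (fun i => B i `&` B' i); split.
  + move=> i; rewrite mem_cat negb_or => /andP[si si'].
    by rewrite sB// sB'// setIT.
  + by move=> i; exact: measurableI.
  + by apply/seteqP; split=> [y [By B'y] i|y BB'y]; split=> // i; case: (BB'y i).
- by apply/seteqP; split=> // y _; exists 0%N.
- by move=> _ [s [B [sB mB ->]]]; exact: m12 sB mB.
Qed.

Hypothesis A_finite : finite_set [set: A].
Hypothesis A_discrete : forall C : set A, measurable C.
Variable delta : R.
Hypothesis delta0 : 0 < delta.
Hypothesis marg_ge : forall i a, (delta%:E <= marg i [set a])%E.

Definition coordinate_swap i a b (y : Y) : Y :=
  mk (fun j => if j == i then swap a b (c y j) else c y j).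

Lemma c_coordinate_swap i a b y j :
  c (coordinate_swap i a b y) j = if j == i then swap a b (c y j) else c y j.
Proof. by rewrite /coordinate_swap (coordinatesK indep). Qed.

Lemma coordinate_swap_involutive i a b : involutive (coordinate_swap i a b).
Proof.
move=> y; apply: (can_inj (of_coordinatesK indep)); apply/funext => j.
by rewrite !c_coordinate_swap; case: eqP => // _; rewrite swap_involutive.
Qed.

Lemma measurable_coordinate_swap i a b :
  measurable_fun [set: Y] (coordinate_swap i a b).
Proof.
apply: (measurability _ (coordinates_generate indep)) => _ [_ [j _ [C _ <-]] <-].
rewrite setTI; have [ji|ji] := eqVneq j i.
  rewrite (_ : _ @^-1` _ = (fun y => c y j) @^-1` (swap a b @^-1` C)).
    exact: measurable_side.
  by apply/seteqP; split=> y /=; rewrite c_coordinate_swap ji eqxx.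
rewrite (_ : _ @^-1` _ = (fun y => c y j) @^-1` C).
  exact: measurable_side.
by apply/seteqP; split=> y /=; rewrite c_coordinate_swap (negbTE ji).
Qed.

Lemma coordinate_swap_box i a b B :
  coordinate_swap i a b @^-1` box c B = box c (replace_side B i (swap a b @^-1` (B i))).
Proof.
apply/seteqP; split=> y /= By j; have := By j;
  by rewrite c_coordinate_swap /replace_side; case: eqVneq => // ->.
Qed.

(** On the event that coordinate [i] is [x], the swap replaces the factor [marg
i [set x]] of a box by that of the swapped letter; both sides are measures in
[E], so that boxes suffice. The formula is multiplied out to avoid dividing by
a possibly null marginal. *)
Lemma coordinate_swap_formula i a b x E : measurable E ->
  (marg i [set x] *
     nu (coordinate_swap i a b @^-1` (E `&` (fun y => c y i) @^-1` [set x])) =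
   marg i [set swap a b x] * nu (E `&` (fun y => c y i) @^-1` [set x]))%E.
Proof.
move=> mE.
have mX : measurable ((fun y => c y i) @^-1` [set x]) := measurable_side i (A_discrete [set x]).
have mt := measurable_coordinate_swap i a b.
pose q z : {nonneg R} := NngNum (fine_ge0 (measure_ge0 (marg i) [set z])).
have qE z : ((q z)%:num%:E = marg i [set z])%E.
  by rewrite /q /= fineK// fin_num_measure.
pose m1 : {measure set Y -> \bar R} :=
  mscale (q x) (mrestr (image_probability nu mt) mX).
pose m2 : {measure set Y -> \bar R} := mscale (q (swap a b x)) (mrestr nu mX).
have m1E X : m1 X = (marg i [set x] *
    nu (coordinate_swap i a b @^-1` (X `&` (fun y => c y i) @^-1` [set x])))%E.
  by rewrite -qE.
have m2E X : m2 X = (marg i [set swap a b x] *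
    nu (X `&` (fun y => c y i) @^-1` [set x]))%E.
  by rewrite -qE.
rewrite -m1E -m2E; apply: box_measure_unique => //.
  rewrite m1E; apply: (@le_lt_trans _ _ 1%E); last exact: ltry.
  rewrite -[leRHS]mule1; apply: lee_pmul => //; apply: probability_le1 => //.
  by apply: measurable_preimage => //; rewrite setTI.
move=> s B sB mB; rewrite m1E m2E.
have boxI : box c B `&` (fun y => c y i) @^-1` [set x] =
    box c (replace_side B i (B i `&` [set x])).
  apply/seteqP; split=> [y [/= By <-] j|y By].
    by rewrite /replace_side; case: eqP => // ->.
  have := By i; rewrite replace_sideE => -[Bi xi]; split=> //= j.
  by have := By j; rewrite /replace_side; case: eqP => [->[]|].
have sB' C := @supported_on_cons _ _ s i B C sB.
rewrite boxI coordinate_swap_box replace_sideE replace_sideK.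
rewrite !(box_factor indep i (sB' _) (fun=> A_discrete _)) !replace_sideE !replace_sideK.
have [Bx|nBx] := pselect (B i x).
  rewrite (_ : B i `&` _ = [set x]); last first.
    by apply/seteqP; split=> [z []//|z ->].
  rewrite (_ : swap a b @^-1` _ = [set swap a b x]); last first.
    apply/seteqP; split=> z /= => [<-|->]; by rewrite swap_involutive.
  by rewrite !muleA (muleC (marg i [set x])).
rewrite (_ : B i `&` _ = set0); last first.
  by apply/seteqP; split=> z // [Bz zx]; rewrite zx in Bz.
by rewrite preimage_set0 measure0 !(mul0e, mule0).
Qed.

Lemma alphabet_partition (E : set Y) (f : Y -> A) : measurable E ->
  (forall C, measurable (f @^-1` C)) ->
  nu E = (\sum_(x <- fset_set [set: A]) nu (E `&` f @^-1` [set x]))%E.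
Proof.
move=> mE mf; rewrite -measure_fbigsetU; last 2 first.
- by move=> x _; exact: measurableI.
- by move=> x x' _ _ [y [[_ <-] [_ <-]]].
congr (nu _); rewrite -bigcup_fset; apply/seteqP; split=> [y Ey|y [x _ []]//].
by exists (f y) => //=; rewrite in_fset_set ?inE.
Qed.

(** On each event where coordinate [i] is [x], the swap multiplies the measure
by a quotient of two marginal probabilities, hence by at most [delta^-1]. *)
Lemma coordinate_swap_quasi_invariant i a b :
  quasi_invariant nu delta^-1 (coordinate_swap i a b).
Proof.
have mt := measurable_coordinate_swap i a b.
split=> // E mE; have mtE := measurable_preimage mt mE.
rewrite (alphabet_partition (f := fun y => c (coordinate_swap i a b y) i) mtE); last first.
  move=> C; exact: (measurable_preimage mt (measurable_side i (A_discrete C))).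
rewrite (alphabet_partition mE (fun C => measurable_side i (A_discrete C))) ge0_sume_distrr//.
apply: lee_sum => x _.
have -> : coordinate_swap i a b @^-1` E `&`
      (fun y => c (coordinate_swap i a b y) i) @^-1` [set x] =
    coordinate_swap i a b @^-1` (E `&` (fun y => c y i) @^-1` [set x]) by [].
have mEx : measurable (E `&` (fun y => c y i) @^-1` [set x]).
  by apply: measurableI => //; exact: measurable_side.
have := coordinate_swap_formula i a b x mE.
set p := nu (_ @^-1` (_ `&` _)); set p' := nu _ => H.
rewrite lee_pdivlMl//.
apply: (@le_trans _ _ (marg i [set x] * p)%E).
  by apply: lee_wpmul2r; [exact: measure_ge0|exact: marg_ge].
rewrite H -[leRHS]mul1e; apply: lee_wpmul2r; first exact: measure_ge0.
exact: probability_le1.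
Qed.

End Coordinates.

(** * A zero-one law for swap invariant sets *)

Section ZeroOneLaw.
Context (R : realType) dA (A : measurableType dA) d (Y : measurableType d).
Context (I : choiceType).
Variables (nu : probability Y R) (marg : I -> probability A R).
Variables (c : Y -> I -> A) (mk : (I -> A) -> Y).
Hypothesis A_finite : finite_set [set: A].
Hypothesis A_discrete : forall C : set A, measurable C.
Hypothesis indep : independent_coordinates nu marg c mk.
Variable delta : R.
Hypothesis delta0 : 0 < delta.
Hypothesis marg_ge : forall i a, (delta%:E <= marg i [set a])%E.

Local Notation swp := (coordinate_swap c mk).

Definition swap_invariant_at i (E : set Y) : Prop :=
  forall a b, nu (swp i a b @^-1` E `\` E) = 0%E.

Lemma swap_invariant_measure i a b E X : measurable E -> measurable X ->
  swap_invariant_at i E -> nu (swp i a b @^-1` E `&` X) = nu (E `&` X).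
Proof.
move=> mE mX iE; set t := swp i a b.
have tt : involutive t := coordinate_swap_involutive indep i a b.
have qt := coordinate_swap_quasi_invariant indep A_finite A_discrete delta0 marg_ge i a b.
have [mt _] := qt; rewrite -/t in mt.
have mtE : measurable (t @^-1` E) by exact: measurable_preimage.
have D1 : nu (t @^-1` E `\` E) = 0%E by exact: iE.
have D2 : nu (E `\` t @^-1` E) = 0%E.
  rewrite (_ : E `\` t @^-1` E = t @^-1` (t @^-1` E `\` E)); last first.
    by apply/seteqP; split=> y /=; rewrite tt.
  by apply: quasi_invariant_null qt _ D1; exact: measurableD.
have le0 (E1 E2 : set Y) : measurable E1 -> measurable E2 ->
    nu (E1 `\` E2) = 0%E -> (nu (E1 `&` X) <= nu (E2 `&` X))%E.
  move=> m1 m2 D.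
  apply: (@le_trans _ _ (nu ((E2 `&` X) `|` (E1 `\` E2)))).
    rewrite le_measure ?inE//; first exact: measurableI.
      by apply: measurableU; [exact: measurableI|exact: measurableD].
    by move=> y [E1y Xy]; have [|] := pselect (E2 y) => ?; [left|right].
  have mI : measurable (E2 `&` X) by exact: measurableI.
  have mD : measurable (E1 `\` E2) by exact: measurableD.
  have : (nu ((E2 `&` X) `|` (E1 `\` E2)) <= nu (E2 `&` X) + nu (E1 `\` E2))%E.
    exact: measureU2.
  by rewrite D adde0.
by apply/eqP; rewrite eq_le !le0.
Qed.

(** For swap invariant [E], the swap formula says that the measure of [E]
intersected with [c y i = x] is proportional, as [x] varies, to [marg i [set
x]]; summing over [x] identifies the constant. *)
Lemma swap_invariant_coordinate i a E : measurable E -> swap_invariant_at i E ->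
  nu (E `&` (fun y => c y i) @^-1` [set a]) = (marg i [set a] * nu E)%E.
Proof.
move=> mE iE.
have mc C := measurable_preimage (measurable_coordinate indep i) (A_discrete C).
rewrite (alphabet_partition nu A_finite mE mc) ge0_sume_distrr//.
transitivity (\sum_(x <- fset_set [set: A])
   marg i [set x] * nu (E `&` (fun y => c y i) @^-1` [set a]))%E.
  have p1 : (\sum_(x <- fset_set [set: A]) marg i [set x] = 1)%E.
    rewrite -(probability_setT (marg i)) -measure_fbigsetU; last 2 first.
    - by move=> x _.
    - by move=> x x' _ _ [y [-> ->]].
    congr (marg i _); rewrite -bigcup_fset; apply/seteqP; split=> // x _.
    by exists x => //=; rewrite in_fset_set ?inE.
  by rewrite -ge0_sume_distrl// p1 mul1e.
apply: eq_bigr => x _.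
have := coordinate_swap_formula indep A_discrete i a x x mE.
rewrite swapR preimage_setI => <-; congr (_ * _)%E.
rewrite -(swap_invariant_measure a x mE (mc [set a]) iE).
congr (nu (_ `&` _)); apply/seteqP; split=> y /=;
  rewrite (c_coordinate_swap indep) eqxx.
  by move=> ->; rewrite /swap eqxx.
by move=> sx; rewrite -(swap_involutive a x (c y i)) sx swapR.
Qed.

Lemma swap_invariant_coordinate_set i C E : measurable E -> swap_invariant_at i E ->
  nu (E `&` (fun y => c y i) @^-1` C) = (marg i C * nu E)%E.
Proof.
move=> mE iE; have mc C := measurable_preimage (measurable_coordinate indep i) (A_discrete C).
have mEC : measurable (E `&` (fun y => c y i) @^-1` C) by exact: measurableI.
rewrite (alphabet_partition nu A_finite mEC mc).
have -> : marg i C = (\sum_(x <- fset_set [set: A]) marg i (C `&` [set x]))%E.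
  rewrite -measure_fbigsetU; last 2 first.
  - by move=> x _.
  - by move=> x x' _ _ [y [[_ ->] [_ ->]]].
  congr (marg i _); rewrite -bigcup_fset; apply/seteqP; split=> [x Cx|x [z _ []]//].
  by exists x => //=; rewrite in_fset_set ?inE.
rewrite ge0_sume_distrl//; apply: eq_bigr => x _.
have [Cx|nCx] := pselect (C x).
  rewrite (_ : C `&` _ = [set x]); last by apply/seteqP; split=> [z []//|z ->].
  rewrite -swap_invariant_coordinate//; congr (nu _).
  by apply/seteqP; split=> [y [[]]//|y [Ey /= yx]]; split=> //; split=> //=; rewrite yx.
rewrite (_ : C `&` _ = set0); last first.
  by apply/seteqP; split=> z // [Cz zx]; rewrite zx in Cz.
rewrite (_ : _ `&` _ = set0) ?measure0 ?mul0e//.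
by apply/seteqP; split=> y // [[_ /= Cy] yx]; rewrite yx in Cy.
Qed.

(** Sides are removed one at a time: a swap at coordinate [i] does not affect
the other sides, so that [E] intersected with them is still invariant under
swaps at [i]. *)
Lemma swap_invariant_box s B E : measurable E -> (forall i, swap_invariant_at i E) ->
  supported_on s B -> nu (E `&` box c B) = (nu E * nu (box c B))%E.
Proof.
move=> mE iE; elim: s B => [|i s IH] B sB.
  have -> : box c B = setT.
    by apply/seteqP; split=> // y _ i; rewrite sB.
  by rewrite setIT probability_setT mule1.
have sB' := supported_onT sB.
have mB' := measurable_box indep sB' (fun=> A_discrete _).
rewrite (box_split c B i) setIC -setIA setIC (setIC (box _ _)).
rewrite swap_invariant_coordinate_set//; last 2 first.
- exact: measurableI.
- move=> a b; rewrite preimage_setI (coordinate_swap_box indep) replace_sideE replace_sideK.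
  rewrite preimage_setT; apply: (subset_measure0 _ _ _ (iE i a b)).
  + apply: measurableD; apply: measurableI => //.
    apply: measurable_preimage => //.
    by have [] := coordinate_swap_quasi_invariant indep A_finite A_discrete delta0 marg_ge i a b.
  + apply: measurableD => //; apply: measurable_preimage => //.
    by have [] := coordinate_swap_quasi_invariant indep A_finite A_discrete delta0 marg_ge i a b.
  + by move=> y [[tE By] nEB]; split=> // Ey; apply: nEB.
rewrite IH// -box_split (box_factor indep i sB (fun=> A_discrete _)).
by rewrite muleCA.
Qed.

(** A swap invariant set is independent of all boxes, hence of every measurable
set, in particular of its own complement. *)
Lemma swap_invariant_zero_one E : measurable E -> (forall i, swap_invariant_at i E) ->
  nu E = 0%E \/ nu (~` E) = 0%E.
Proof.
move=> mE iE.
pose q : {nonneg R} := NngNum (fine_ge0 (measure_ge0 nu E)).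
have qE : (q%:num%:E = nu E)%E by rewrite /q /= fineK// fin_num_measure.
pose m1 : {measure set Y -> \bar R} := mrestr nu mE.
pose m2 : {measure set Y -> \bar R} := mscale q nu.
have m2E X : m2 X = (nu E * nu X)%E by rewrite -qE.
have : m1 (~` E) = m2 (~` E).
  apply: (box_measure_unique indep); last exact: measurableC.
    apply: (@le_lt_trans _ _ 1%E); last exact: ltry.
    by apply: probability_le1; exact: measurableI.
  by move=> s B sB _; rewrite m2E -(swap_invariant_box mE iE sB) setIC.
rewrite m2E [m1 _](_ : _ = 0%E); last first.
  by rewrite -(measure0 nu); congr (nu _); rewrite setICl.
by move=> /esym/eqP; rewrite mule_eq0 => /orP[] /eqP ->; [left|right].
Qed.

End ZeroOneLaw.

(** * Weak mixing of actions permuting independent coordinates *)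

Lemma ae_forall_countable (R : realType) d (W : measurableType d)
    (P : probability W R) (T : choiceType) (Q : T -> W -> Prop) :
  countable [set: T] -> (forall t, {ae P, forall x, Q t x}) ->
  {ae P, forall x t, Q t x}.
Proof.
move=> /countable_injP[f fI] H.
suff : {ae P, forall x n t, f t = n -> Q t x}.
  by apply: filterS => x Hx t; exact: (Hx (f t)).
apply/ae_foralln => n; have [[t <-]|nt] := pselect (exists t, f t = n).
  by apply: filterS (H t) => x Qx t' /fI -> //; rewrite in_setT.
by apply: aeW => x t ft; case: nt; exists t.
Qed.

Section Insensitive.
Context (G : groupType) d (W : measurableType d) (U : G -> W -> W) (t : W -> W).

Lemma insensitive0 : eventually_insensitive U t set0.
Proof. by exists fset0. Qed.

Lemma insensitiveC L : eventually_insensitive U t L -> eventually_insensitive U t (~` L).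
Proof. by move=> [K LK]; exists K => g gK x; split=> nL /(LK _ gK). Qed.

Lemma insensitiveU L M : eventually_insensitive U t L ->
  eventually_insensitive U t M -> eventually_insensitive U t (L `|` M).
Proof.
move=> [K LK] [K' MK']; exists (K `|` K')%fset => g.
rewrite inE negb_or => /andP[gK gK'] x; have := LK g gK x; have := MK' g gK' x.
by rewrite /setU /=; tauto.
Qed.

End Insensitive.

Section CoordinateAction.
Context (R : realType) (G : groupType) dA (A : measurableType dA).
Context d (Y : measurableType d) (I : choiceType).
Variables (nu : probability Y R) (marg : I -> probability A R).
Variables (c : Y -> I -> A) (mk : (I -> A) -> Y).
Hypothesis A_finite : finite_set [set: A].
Hypothesis A_discrete : forall C : set A, measurable C.
Hypothesis indep : independent_coordinates nu marg c mk.
Variable delta : R.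
Hypothesis delta0 : 0 < delta.
Hypothesis marg_ge : forall i a, (delta%:E <= marg i [set a])%E.
Variables (Q : G -> Y -> Y) (rho : G -> I -> I).
Hypothesis Q_action : borel_action Q.
Hypothesis c_action : forall g y i, c (Q g y) i = c y (rho g i).
Hypothesis rhoK : forall g, cancel (rho g) (rho g^-1%g).
Hypothesis rho_proper : forall i j, finite_set [set g | rho g i = j].

Local Notation swp := (coordinate_swap c mk).

Lemma conjugate_coordinate_swap i a b g :
  conjugate Q (swp i a b) g = swp (rho g^-1%g i) a b.
Proof.
apply/funext => y; apply: (can_inj (of_coordinatesK indep)); apply/funext => j.
rewrite /conjugate c_action !(c_coordinate_swap indep) c_action rhoK.
congr (if _ then _ else _); apply/eqP/eqP => [<-|->]; first by rewrite rhoK.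
by rewrite -{1}(invgK g) rhoK.
Qed.

Lemma coordinate_swap_uniformly_quasi_invariant i a b :
  uniformly_quasi_invariant nu Q delta^-1 (swp i a b).
Proof.
split; first exact: (coordinate_swap_involutive indep).
move=> g; rewrite conjugate_coordinate_swap.
exact: (coordinate_swap_quasi_invariant indep A_finite A_discrete delta0 marg_ge).
Qed.

Context d' (Z : measurableType d').
Variables (la : probability Z R) (S : G -> Z -> Z).

Definition cylinders : set (set (Y * Z)) :=
  [set fst @^-1` X | X in coordinate_sets c] `|` [set snd @^-1` D | D in measurable].

Lemma cylinders_generate : (measurable : set (set (Y * Z))) = <<s cylinders>>.
Proof.
apply/seteqP; split.
  apply: smallest_sub; first exact: smallest_sigma_algebra.
  rewrite subUset; split; last first.
    by move=> _ [D mD <-]; rewrite setTI; apply: sub_sigma_algebra; right; exists D.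
  move=> _ [X mX <-]; rewrite setTI.
  suff : <<s coordinate_sets c>> `<=` [set X | <<s cylinders>> (fst @^-1` X)].
    by apply; rewrite -(coordinates_generate indep).
  apply: smallest_sub; last first.
    by move=> {mX}X cX; apply: sub_sigma_algebra; left; exists X.
  split.
  - by rewrite /= preimage_set0; exact: sigma_algebra0.
  - by move=> X' /= sX; rewrite setTD preimage_setC -setTD; exact: sigma_algebraCD.
  - by move=> F /= sF; rewrite preimage_bigcup; exact: sigma_algebra_bigcup.
apply: smallest_sub; first exact: sigma_algebra_measurable.
rewrite subUset; split=> [_ [X [i _ [C mC <-]] <-]|_ [D mD <-]].
  apply: (measurable_preimage (@measurable_fst _ _ Y Z)).
  exact: measurable_preimage (measurable_coordinate indep i) mC.
exact: (measurable_preimage (@measurable_snd _ _ Y Z)).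
Qed.

(** A condition on coordinate [j] of [Q g y] is one on coordinate [rho g j] of
[y], so it notices a swap at [i] only for the finitely many [g] with [rho g j =
i]. *)
Lemma approximable_by_insensitive i a b B : measurable B ->
  approximable (product_probability nu la)
    (eventually_insensitive (product_action Q S) (lift_map (swp i a b))) B.
Proof.
move: B; apply: (approximable_generated (@insensitive0 _ _ _ _ _)
  (@insensitiveC _ _ _ _ _) (@insensitiveU _ _ _ _ _) cylinders_generate).
move=> X cX e e0.
have mX : measurable X by rewrite cylinders_generate; exact: sub_sigma_algebra.
exists X; last first.
  by split=> //; rewrite setDv setU0 measure0 lee_fin ltW.
case: cX => [[_ [j _ [C _ <-]] <-]|[D mD <-]]; last by exists fset0.
exists (fset_set [set g | rho g j = i]) => g.
rewrite in_fset_set//= => /negP; rewrite inE /= => gi [y z] /=.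
by rewrite !c_action (c_coordinate_swap indep); case: eqP.
Qed.

End CoordinateAction.

(** Slices of an invariant set are swap invariant, hence null or conull;
nonsingularity makes the set of [z] with non-null slice invariant under [S]. *)
Theorem coordinate_action_weakly_mixing (R : realType) (G : groupType)
    dA (A : measurableType dA) d (Y : measurableType d) (I : choiceType)
    (nu : probability Y R) (marg : I -> probability A R)
    (c : Y -> I -> A) (mk : (I -> A) -> Y) (delta : R)
    (Q : G -> Y -> Y) (rho : G -> I -> I) :
  finite_set [set: A] -> (forall C : set A, measurable C) ->
  countable [set: I] ->
  independent_coordinates nu marg c mk ->
  0 < delta -> (forall i a, (delta%:E <= marg i [set a])%E) ->
  borel_action Q -> (forall g y i, c (Q g y) i = c y (rho g i)) ->
  (forall g, cancel (rho g) (rho g^-1%g)) ->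
  (forall i j, finite_set [set g | rho g i = j]) ->
  countable [set: G] -> infinite_set [set: G] -> amenable R G ->
  nonsingular nu Q -> conservative nu Q -> weakly_mixing nu Q.
Proof.
move=> fA dscA cI indep delta0 marg_ge Q_action c_action rhoK rho_proper.
move=> cG iG aG ns cons d' Z la S _ S_action S_mp S_erg B mB BU.
have BU' g : product_action Q S g @^-1` B = B by exact: BU.
have delta'0 : 0 <= delta^-1 by rewrite invr_ge0 ltW.
have null : {ae la, forall z (iab : I * A * A),
    nu (coordinate_swap c mk iab.1.1 iab.1.2 iab.2 @^-1` slice B z `\` slice B z) = 0%E}.
  apply: ae_forall_countable.
    have cA := finite_set_countable fA.
    by rewrite -!setXTT; apply: countableX => //; apply: countableX.
  move=> [[i a] b] /=.
  apply: (slice_displacement_null Q_action S_action S_mp cG iG aG ns cons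
    (coordinate_swap_uniformly_quasi_invariant fA dscA indep delta0 marg_ge
       c_action rhoK i a b) delta'0 mB BU').
  exact: (approximable_by_insensitive indep c_action rho_proper).
have zero_one : {ae la, forall z, nu (slice B z) = 0%E \/ nu (~` slice B z) = 0%E}.
  apply: filterS null => z null.
  apply: (swap_invariant_zero_one fA dscA indep delta0 marg_ge).
    exact: measurable_slice.
  by move=> i a b; exact: (null (i, a, b)).
pose D := [set z | nu (slice B z) != 0%E].
have mD : measurable D.
  rewrite (_ : D = (fun z => nu (slice B z)) @^-1` (~` [set 0%E])).
    apply: measurable_preimage; first exact: measurable_fun_slice.
    exact: measurableC.
  by apply/seteqP; split=> z /= /eqP.
have DS g : S g @^-1` D = D.
  have BE z : slice B z = Q g @^-1` slice B (S g z).
    by rewrite /slice -[in LHS](BU' g).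
  apply/seteqP; split=> z /=; apply: contra_neq; rewrite (BE z).
    by move/(nonsingular_preimage Q_action g ns (measurable_slice _ mB)).
  by move=> H; apply/(nonsingular_preimage Q_action g ns (measurable_slice _ mB)).
have [D0|D0] := S_erg D mD DS.
  left; apply/(product_probability_eq0 nu la mB).
  exists D; split=> // z /= H; exact/eqP.
right; apply/(product_probability_eq0 nu la (measurableC mB)).
have aeD : {ae la, forall z, D z} by exists (~` D); split=> //; exact: measurableC.
apply: filterS2 zero_one aeD => z [e|//].
by rewrite /D /= e eqxx.
Qed.

(** * The shift and its powers *)

Section ProductCoordinates.
Context (R : realType) (I : choiceType) d (T : measurableType d).
Variables (nu : I -> probability T R) (m : probability (funspace I T) R).

Lemma product_measure_coordinates : is_product_measure nu m ->
  independent_coordinates m nu (fun (x : funspace I T) i => x i) id.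
Proof.
move=> mE; split=> // s B i sB mB.
pose F : {fset I} := (i |` [fset j | j in s])%fset.
have iF : i \in F by rewrite !inE eqxx.
have -> : box (fun (x : funspace I T) i => x i) B =
    [set x : funspace I T | forall j, j \in F -> B j (x j)].
  apply/seteqP; split=> [x Bx j _|x Bx j]; first exact: Bx.
  have [jF|jF] := boolP (j \in F); first exact: Bx.
  by rewrite sB//; move: jF; rewrite !inE negb_or => /andP[].
have -> : box (fun (x : funspace I T) i => x i) (replace_side B i setT) =
    [set x : funspace I T | forall j, j \in (F `\ i)%fset -> B j (x j)].
  apply/seteqP; split=> [x Bx j|x Bx j].
    by rewrite !inE => /andP[ji _]; have := Bx j; rewrite /replace_side (negbTE ji).
  rewrite /replace_side; case: eqVneq => [//|ji].
  have [jF|jF] := boolP (j \in F); first by apply: Bx; rewrite in_fsetD1 ji.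
  by rewrite sB//; move: jF; rewrite !inE negb_or => /andP[].
by rewrite !mE// (big_fsetD1 i).
Qed.

Lemma measurable_funspace_map (f : funspace I T -> funspace I T) :
  (forall i, measurable_fun [set: funspace I T] (fun x => f x i)) ->
  measurable_fun [set: funspace I T] f.
Proof.
move=> mf; apply: (@measurability _ _ _ (funspace I T) _ _ (@coord_preimages I d T)) => //.
move=> _ [_ [i _ [C mC <-]] <-]; rewrite setTI.
exact: measurable_preimage (mf i) mC.
Qed.

Lemma measurable_eval i : measurable_fun [set: funspace I T] (fun x => x i).
Proof.
by move=> _ C mC; rewrite setTI; apply: sub_sigma_algebra; exists i => //; exists C.
Qed.

End ProductCoordinates.

Section PowerNull.
Context (R : realType) (p : nat) d (X : measurableType d).
Variables (mu : probability X R) (mup : probability (funspace 'I_p X) R).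
Hypothesis mup_product : is_product_measure (fun=> mu) mup.

Let indep := product_measure_coordinates mup_product.

Definition insert_coordinate (l : 'I_p) (xy : X * funspace 'I_p X) : funspace 'I_p X :=
  fun k => if k == l then xy.1 else xy.2 k.

Lemma measurable_insert_coordinate l : measurable_fun setT (insert_coordinate l).
Proof.
apply: (@measurability _ _ _ (funspace 'I_p X) _ _ (@coord_preimages 'I_p d X)) => //.
move=> _ [_ [k _ [C mC <-]] <-]; rewrite setTI.
have [kl|kl] := eqVneq k l.
  rewrite (_ : _ @^-1` _ = fst @^-1` C).
    exact: (measurable_preimage (@measurable_fst _ _ X (funspace 'I_p X))).
  by apply/seteqP; split=> xy /=; rewrite /insert_coordinate kl eqxx.
rewrite (_ : _ @^-1` _ = snd @^-1` ((fun x : funspace 'I_p X => x k) @^-1` C)).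
  apply: (measurable_preimage (@measurable_snd _ _ X (funspace 'I_p X))).
  exact: measurable_preimage (@measurable_eval _ _ _ k) mC.
by apply/seteqP; split=> xy /=; rewrite /insert_coordinate (negbTE kl).
Qed.

(** A fresh independent value may be put at coordinate [l] without changing the
law; this turns a question about one coordinate of the product into one about
slices. *)
Lemma insert_coordinate_measure l E : measurable E ->
  mup E = product_probability mu mup (insert_coordinate l @^-1` E).
Proof.
move=> mE; have mi := measurable_insert_coordinate l.
rewrite -(image_probabilityE _ mi).
apply: (box_measure_unique indep) => //.
  by apply: (@le_lt_trans _ _ 1%E); [exact: probability_le1|exact: ltry].
move=> s B sB mB.
pose H : set (funspace 'I_p X) :=
  box (fun (x : funspace 'I_p X) i => x i) (replace_side B l setT).
have mH : measurable H.
  apply: (measurable_box indep (supported_onT (i := l) (s := s) _)).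
    by move=> i si; apply: sB; move: si; rewrite in_cons negb_or => /andP[].
  by move=> i; rewrite /replace_side; case: ifP.
transitivity (mu (B l) * mup H)%E; first exact: (box_factor indep l sB mB).
transitivity (product_probability mu mup (B l `*` H)).
  exact/esym/product_measure1E.
congr (product_probability mu mup _); apply/seteqP; split=> -[x y] /=; last first.
  move=> Bxy; split; first by have := Bxy l; rewrite /insert_coordinate eqxx.
  move=> k; have := Bxy k; rewrite /insert_coordinate /replace_side.
  by case: eqVneq.
move=> [Bx Hy] k; have := Hy k; rewrite /insert_coordinate /replace_side.
by case: eqVneq => [->|].
Qed.

Variable f : X -> X.
Hypothesis mf : measurable_fun [set: X] f.
Hypothesis f_null : forall E, measurable E -> mu E = 0%E -> mu (f @^-1` E) = 0%E.

Definition map_coordinates (s : seq 'I_p) (x : funspace 'I_p X) : funspace 'I_p X :=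
  fun k => if k \in s then f (x k) else x k.

Lemma measurable_map_coordinates s :
  measurable_fun [set: funspace 'I_p X] (map_coordinates s).
Proof.
apply: measurable_funspace_map => k; rewrite /map_coordinates.
case: (k \in s); last exact: measurable_eval.
by apply: measurableT_comp => //; exact: measurable_eval.
Qed.

(** Applying [f] at coordinate [l] after inserting [x] there is inserting [f
x], so null sets can be pulled back slice by slice. *)
Lemma map_coordinate_null l E : measurable E ->
  mup E = 0%E -> mup (map_coordinates [:: l] @^-1` E) = 0%E.
Proof.
move=> mE; have mi := measurable_insert_coordinate l.
have mlE := measurable_preimage (measurable_map_coordinates [:: l]) mE.
rewrite !(insert_coordinate_measure l)//.
have mE' := measurable_preimage mi mE.
have mlE' := measurable_preimage mi mlE.
move/(product_probability_eq0 _ _ mE') => E0.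
apply/(product_probability_eq0 _ _ mlE'); apply: filterS E0 => y E0.
have := f_null (measurable_slice y mE') E0; congr (mu _ = _).
apply/seteqP; split=> x; rewrite /slice /=; congr E;
  apply/funext => k; rewrite /insert_coordinate /map_coordinates inE /=;
  by case: eqVneq.
Qed.

Lemma map_coordinates_null s E : uniq s -> measurable E ->
  mup E = 0%E -> mup (map_coordinates s @^-1` E) = 0%E.
Proof.
elim: s E => [|l s IH] E //= /andP[ls us] mE E0.
have -> : map_coordinates (l :: s) @^-1` E =
    map_coordinates s @^-1` (map_coordinates [:: l] @^-1` E).
  apply/seteqP; split=> x /=; congr E; apply/funext => k;
    rewrite /map_coordinates !inE; case: eqVneq => [->|]//=;
    by rewrite (negbTE ls).
apply: IH => //; last exact: map_coordinate_null.
exact: measurable_preimage (measurable_map_coordinates [:: l]) mE.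
Qed.

End PowerNull.

Section Shift.
Context (R : realType) (G : groupType) dA (A : measurableType dA).

Lemma shift_action_borel : borel_action (@shift_action G dA A).
Proof.
split.
- by move=> x; apply/funext => h; rewrite /shift_action invg1 mul1g.
- by move=> g h x; apply/funext => k; rewrite /shift_action invgM mulgA.
- move=> g; apply: measurable_funspace_map => k; exact: measurable_eval.
Qed.

Lemma shift_proper (i j : G) : finite_set [set g : G | (g^-1 * i)%g = j].
Proof.
apply: (@sub_finite_set _ _ [set (i * j^-1)%g]); last exact: finite_set1.
by move=> g /= <-; rewrite invgM invgK mulgA mulgV mul1g.
Qed.

Lemma shiftK (g i : G) : (g^-1^-1 * (g^-1 * i))%g = i.
Proof. by rewrite invgK mulgA mulgV mul1g. Qed.

Variables (mu_ : G -> probability A R) (mu : probability (funspace G A) R).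
Hypothesis mu_product : is_product_measure mu_ mu.

Variable p : nat.
Variable mup : probability (funspace 'I_p (funspace G A)) R.
Hypothesis mup_product : is_product_measure (fun=> mu) mup.

Lemma diag_action_borel : borel_action (diag_action p (@shift_action G dA A)).
Proof.
have [Q1 QM mQ] := shift_action_borel; split.
- by move=> x; apply/funext => l; rewrite /diag_action Q1.
- by move=> g h x; apply/funext => l; rewrite /diag_action QM.
- move=> g; apply: measurable_funspace_map => l.
  by apply: measurableT_comp => //; exact: measurable_eval.
Qed.

Lemma diag_action_nonsingular : nonsingular mu (@shift_action G dA A) ->
  nonsingular mup (diag_action p (@shift_action G dA A)).
Proof.
move=> ns.
have null g E : measurable E -> mup E = 0%E ->
    mup (diag_action p (@shift_action G dA A) g @^-1` E) = 0%E.
  have -> : diag_action p (@shift_action G dA A) g =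
      map_coordinates (@shift_action G dA A g) (enum 'I_p).
    by apply/funext => x; apply/funext => l; rewrite /map_coordinates mem_enum.
  apply: (map_coordinates_null mup_product) => //; last exact: enum_uniq.
    by case: shift_action_borel.
  by move=> {}E mE H; apply/(nonsingular_preimage shift_action_borel g ns mE).
move=> g E mE; rewrite (action_imageE diag_action_borel); split=> [E0|]; last exact: null.
have mgE : measurable (diag_action p (@shift_action G dA A) g^-1%g @^-1` E).
  by apply: measurable_preimage => //; case: diag_action_borel.
have := null g _ mgE E0; congr (mup _ = _); apply/seteqP.
have [D1 DM _] := diag_action_borel.
by split=> x /=; rewrite -DM mulVg D1.
Qed.

(** Factoring out the side [(l, h)] of a box is done in two steps: first split
off factor [l] of the power, then coordinate [h] of that factor. *)
Lemma power_coordinates : independent_coordinates mup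
  (fun lh : 'I_p * G => mu_ lh.2)
  (fun (y : funspace 'I_p (funspace G A)) (lh : 'I_p * G) => y lh.1 lh.2)
  (fun (x : 'I_p * G -> A) => (fun l h => x (l, h)) : funspace 'I_p (funspace G A)).
Proof.
have indep := product_measure_coordinates mu_product.
have indep_p := product_measure_coordinates mup_product.
split=> //.
- by move=> x; apply/funext => -[l h].
- apply/seteqP; split.
    apply: smallest_sub; first exact: smallest_sigma_algebra.
    move=> _ [l _ [X mX <-]].
    pose cs := coordinate_sets (fun (y : funspace 'I_p (funspace G A))
      (lh : 'I_p * G) => y lh.1 lh.2).
    suff : <<s @coord_preimages G dA A>> `<=`
        [set X | <<s cs>> ((fun y : 'I_p -> funspace G A => y l) @^-1` X)].
      exact.
    apply: smallest_sub; last first.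
      move=> _ [h _ [C mC <-]]; apply: sub_sigma_algebra.
      by exists (l, h) => //; exists C.
    split.
    + by rewrite /= preimage_set0; exact: sigma_algebra0.
    + by move=> X' /= sX; rewrite setTD preimage_setC -setTD; exact: sigma_algebraCD.
    + by move=> F /= sF; rewrite preimage_bigcup; exact: sigma_algebra_bigcup.
  apply: smallest_sub; first exact: sigma_algebra_measurable.
  move=> _ [[l h] _ [C mC <-]] /=.
  have mX : measurable ((fun x : funspace G A => x h) @^-1` C).
    exact: measurable_preimage (@measurable_eval _ _ _ h) mC.
  exact: measurable_preimage (@measurable_eval _ _ _ l) mX.
- move=> s B [l h] sB mB.
  pose ev (x : funspace G A) (k : G) : A := x k.
  pose Bx (B' : 'I_p * G -> set A) (k : 'I_p) : set (funspace G A) :=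
    box ev (fun h => B' (k, h)).
  have boxE B' : box (fun (y : funspace 'I_p (funspace G A))
      (lh : 'I_p * G) => y lh.1 lh.2) B' =
      box (fun (y : funspace 'I_p (funspace G A)) l => y l) (Bx B').
    by apply/seteqP; split=> [y By k j|y By [k j]]; [exact: (By (k, j))|exact: (By k j)].
  have supB (B' : 'I_p * G -> set A) : supported_on s B' -> forall k,
      supported_on [seq lh.2 | lh <- s] (fun h => B' (k, h)).
    move=> sB' k j js; apply: sB'; apply: contra js => kjs.
    by apply/mapP; exists (k, j).
  have supp (B' : 'I_p -> set (funspace G A)) : supported_on (enum 'I_p) B'.
    by move=> k; rewrite mem_enum.
  rewrite !boxE.
  rewrite (box_factor indep_p l (supp _)); last first.
    by move=> k; exact: (measurable_box indep (supB B sB k) (fun j => mB (k, j))).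
  set B1 := replace_side B (l, h) setT.
  have B1l : (fun j => B1 (l, j)) = replace_side (fun j => B (l, j)) h setT.
    by apply/funext => j; rewrite /B1 /replace_side xpair_eqE eqxx.
  have sB1 : supported_on s B1.
    by move=> i si; rewrite /B1 /replace_side; case: ifP => // _; exact: sB.
  rewrite [RHS](_ : _ = mu_ h (B (l, h)) * (mu (Bx B1 l) *
     mup (box (fun (y : funspace 'I_p (funspace G A)) l => y l)
       (replace_side (Bx B1) l setT))))%E; last first.
    congr (_ * _)%E; apply: (box_factor indep_p l (supp _)).
    move=> k; apply: (measurable_box indep (supB B1 sB1 k)) => j.
    by rewrite /B1 /replace_side; case: ifP.
  have -> : replace_side (Bx B1) l setT = replace_side (Bx B) l setT.
    apply/funext => k; rewrite /replace_side; case: eqVneq => // kl.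
    rewrite /Bx; congr (box _ _); apply/funext => j.
    by rewrite /B1 /replace_side xpair_eqE (negbTE kl).
  have -> : mu (Bx B l) = (mu_ h (B (l, h)) * mu (Bx B1 l))%E.
    rewrite /Bx B1l; exact: (box_factor indep h (supB B sB l) (fun j => mB (l, j))).
  by rewrite muleA.
Qed.

End Shift.

(** * Conclusion *)

(** The infimum is finite because the alphabet is nonempty and probabilities
are at most [1]. *)
Lemma uniform_lower_bound (R : realType) (G : groupType) dA (A : measurableType dA)
    (mu_ : G -> probability A R) :
  (forall C : set A, measurable C) ->
  (0 < ereal_inf [set ereal_inf [set mu_ g [set a] | a in [set: A]]
                 | g in [set: G]])%E ->
  exists2 delta : R, 0 < delta & forall g a, (delta%:E <= mu_ g [set a])%E.
Proof.
move=> A_discrete; set m := ereal_inf _ => m0.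
have mle g a : (m <= mu_ g [set a])%E.
  apply: (@le_trans _ _ (ereal_inf [set mu_ g [set a] | a in [set: A]])).
    by apply: ereal_inf_lbound; exists g.
  by apply: ereal_inf_lbound; exists a.
have mfin : m \is a fin_num.
  rewrite ge0_fin_numE; last exact: ltW.
  apply: le_lt_trans (mle 1%g point) _.
  exact: le_lt_trans (probability_le1 _ (A_discrete _)) (ltry _).
exists (fine m); first by rewrite -lte_fin fineK.
by move=> g a; rewrite fineK.
Qed.

Theorem theorem0p2 (R : realType)
    (dA : measure_display) (A : measurableType dA)
    (A_finite : finite_set [set: A])
    (A_discrete : forall B : set A, measurable B)
    (G : groupType)
    (G_countable : countable [set: G])
    (G_infinite : infinite_set [set: G])
    (G_amenable : amenable R G)
    (mu_ : G -> probability A R)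
    (mu : probability (funspace G A) R)
    (mu_product : is_product_measure mu_ mu)
    (T_nonsingular : nonsingular mu (shift_action G A))
    (mu_inf : (0 < ereal_inf [set ereal_inf [set mu_ g [set a] | a in [set: A]]
                             | g in [set: G]])%E) :
  (conservative mu (shift_action G A) -> weakly_mixing mu (shift_action G A)) /\
  (forall (p : nat) (mup : probability (funspace 'I_p (funspace G A)) R),
     (1 < p)%N ->
     is_product_measure (fun _ : 'I_p => mu) mup ->
     conservative mup (diag_action p (shift_action G A)) ->
     weakly_mixing mup (diag_action p (shift_action G A))).
Proof.
have [delta delta0 mu_ge] := uniform_lower_bound A_discrete mu_inf.
split=> [cons|p mup _ mup_product cons].
  apply: (coordinate_action_weakly_mixing (rho := fun g i => (g^-1 * i)%g)
    A_finite A_discrete G_countable (product_measure_coordinates mu_product)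
    delta0 mu_ge (@shift_action_borel _ _ _)) => //.
  - by move=> g i; exact: shiftK.
  - exact: shift_proper.
apply: (coordinate_action_weakly_mixing
  (rho := fun g (lh : 'I_p * G) => (lh.1, g^-1 * lh.2)%g)
  A_finite A_discrete _ (power_coordinates mu_product mup_product)
  delta0 (fun lh => mu_ge lh.2) (@diag_action_borel _ _ _ _)) => //.
- rewrite -setXTT; apply: countableX => //; exact: countableP.
- by move=> g [l i] /=; rewrite shiftK.
- move=> [l i] [l' i']; apply: (sub_finite_set _ (shift_proper i i')).
  by move=> g /= [].
- exact: (diag_action_nonsingular mup_product T_nonsingular).
Qed.
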